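(* Let $\mathcal{A}$ be a Banach algebra and let $I$ be a closed (two-sided) ideal in $\mathcal{A}$. (i) Suppose that $\mathcal{A}/I$ is approximately weakly amenable. Then $I$ has the approximate trace extension property. (ii) Suppose that $\mathcal{A}$ is weakly amenable and $I$ has the approximate trace extension property. Then $\mathcal{A}/I$ is approximately weakly amenable. (iii) Suppose that $I$ is weakly amenable and $\mathcal{A}/I$ is approximately weakly amenable. Then $\mathcal{A}$ is approximately weakly amenable. (iv) Suppose that $\mathcal{A}$ is approximately weakly amenable and $I$ has a quasi-central bounded approximate identity for $\mathcal{A}$. Then $I$ is approximately weakly amenable.
   Context: For a Banach algebra $\mathcal{C}$ and a Banach $\mathcal{C}$-bimodule $\mathcal{X}$, the dual $\mathcal{X}^*$ is a Banach $\mathcal{C}$-bimodule via $\langle x, a\cdot\Lambda\rangle=\langle x\cdot a,\Lambda\rangle$ and $\langle x,\Lambda\cdot a\rangle=\langle a\cdot x,\Lambda\rangle$. This applies in particular to $\mathcal{C}^*$ (with $\mathcal{C}$ a bimodule over itself) and to $I^*$ as an $\mathcal{A}$-bimodule. A derivation $D:\mathcal{C}\to\mathcal{X}$ is a linear map with $D(ab)=a\cdot D(b)+D(a)\cdot b$. It is inner if there is $x\in\mathcal{X}$ with $D(a)=a\cdot x-x\cdot a$ for all $a\in\mathcal{C}$. It is approximately inner if there is a net $(x_\alpha)\subseteq\mathcal{X}$ (not required to be bounded) with $D(a)=\lim_\alpha(a\cdot x_\alpha-x_\alpha\cdot a)$ in norm for every $a\in\mathcal{C}$. $\mathcal{C}$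 is weakly amenable if every bounded derivation $\mathcal{C}\to\mathcal{C}^*$ is inner, and approximately weakly amenable if every bounded derivation $\mathcal{C}\to\mathcal{C}^*$ is approximately inner. A closed ideal $I$ in $\mathcal{A}$ has the approximate trace extension property if for each $\lambda\in I^*$ with $a\cdot\lambda=\lambda\cdot a$ for all $a\in\mathcal{A}$ there is a net $(\Lambda_\alpha)\subseteq\mathcal{A}^*$ such that $\Lambda_\alpha|_I=\lambda$ for every $\alpha$ and $a\cdot\Lambda_\alpha-\Lambda_\alpha\cdot a\to 0$ (in norm) for every $a\in\mathcal{A}$. A bounded approximate identity $\{e_\alpha\}$ of $I$ is quasi-central for $\mathcal{A}$ if $\lim_\alpha\|ae_\alpha-e_\alpha a\|=0$ for all $a\in\mathcal{A}$. *)

(* Defs.v *)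
From HB Require Import structures.
From mathcomp Require Import all_boot all_order all_algebra generic_quotient.
From mathcomp Require Import ring_quotient complex ring lra.
From mathcomp Require Import all_classical all_reals all_analysis.
Set Implicit Arguments.
Unset Strict Implicit.
Unset Printing Implicit Defensive.
Import Order.TTheory GRing.Theory Num.Theory numFieldNormedType.Exports.
Local Open Scope classical_set_scope.
Local Open Scope complex_scope.
Local Open Scope ring_scope.

(* Banach algebras are not assumed to have a unit. *)
HB.mixin Record CompleteNormedModule_isBanachAlgebra (K : numFieldType) A
    & CompleteNormedModule K A := {
  amul : A -> A -> A ;
  amulA : forall a b c, amul a (amul b c) = amul (amul a b) c ;
  amulDl : forall a b c, amul (a + b) c = amul a c + amul b c ;
  amulDr : forall a b c, amul a (b + c) = amul a b + amul a c ;
  amulZl : forall (k : K) a b, amul (k *: a) b = k *: amul a b ;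
  amulZr : forall (k : K) a b, amul a (k *: b) = k *: amul a b ;
  ler_norm_amul : forall a b, `|amul a b| <= `|a| * `|b|
}.

#[short(type="banachAlgType")]
HB.structure Definition BanachAlgebra (K : numFieldType) :=
  {A of CompleteNormedModule K A & CompleteNormedModule_isBanachAlgebra K A}.

Notation "a ** b" := (amul a b) (at level 40, left associativity) : ring_scope.

Section BanachAlgebraTheory.
Variables (K : numFieldType) (A : banachAlgType K).
Implicit Types a b c : A.

Lemma amulBl a b c : (a - b) ** c = a ** c - b ** c.
Proof. by rewrite amulDl -scaleN1r amulZl scaleN1r. Qed.

Lemma amulBr a b c : a ** (b - c) = a ** b - a ** c.
Proof. by rewrite amulDr -scaleN1r amulZr scaleN1r. Qed.

End BanachAlgebraTheory.

(* Bimodule structures are not canonical: the same Banach space may be a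
   bimodule over several algebras, e.g. a closed ideal I of A over A and over
   I. *)
Record banach_bimodule (K : numFieldType) (A : banachAlgType K) :=
    BanachBimodule {
  bimod_sort :> completeNormedModType K ;
  lact : A -> bimod_sort -> bimod_sort ;
  ract : bimod_sort -> A -> bimod_sort ;
  lactDl : forall a b x, lact (a + b) x = lact a x + lact b x ;
  lactDr : forall a x y, lact a (x + y) = lact a x + lact a y ;
  lactZl : forall (k : K) a x, lact (k *: a) x = k *: lact a x ;
  lactZr : forall (k : K) a x, lact a (k *: x) = k *: lact a x ;
  ractDl : forall x y a, ract (x + y) a = ract x a + ract y a ;
  ractDr : forall x a b, ract x (a + b) = ract x a + ract x b ;
  ractZl : forall (k : K) x a, ract (k *: x) a = k *: ract x a ;
  ractZr : forall (k : K) x a, ract x (k *: a) = k *: ract x a ;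
  lactA : forall a b x, lact (a ** b) x = lact a (lact b x) ;
  ractA : forall x a b, ract x (a ** b) = ract (ract x a) b ;
  lractA : forall a x b, ract (lact a x) b = lact a (ract x b) ;
  lact_bounded : exists M : K, forall a x, `|lact a x| <= M * (`|a| * `|x|) ;
  ract_bounded : exists M : K, forall x a, `|ract x a| <= M * (`|x| * `|a|)
}.

Section RegularBimodule.
Variables (K : numFieldType) (A : banachAlgType K).

Definition regular_bimodule : banach_bimodule A.
Proof.
refine (@BanachBimodule K A A (@amul K A) (@amul K A)
  (@amulDl K A) (@amulDr K A) (@amulZl K A) (@amulZr K A)
  (@amulDl K A) (@amulDr K A) (@amulZl K A) (@amulZr K A) _ _ _ _ _).
- by move=> *; rewrite amulA.
- by move=> *; rewrite amulA.
- by move=> *; rewrite amulA.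
- by exists 1 => *; rewrite mul1r ler_norm_amul.
- by exists 1 => *; rewrite mul1r ler_norm_amul.
Defined.

End RegularBimodule.

Record closed_ideal (K : numFieldType) (A : banachAlgType K) := ClosedIdeal {
  ideal_set :> set A ;
  ideal_closed : closed ideal_set ;
  ideal0 : ideal_set 0 ;
  idealD : forall x y, ideal_set x -> ideal_set y -> ideal_set (x + y) ;
  idealZ : forall (k : K) x, ideal_set x -> ideal_set (k *: x) ;
  idealMl : forall a x, ideal_set x -> ideal_set (a ** x) ;
  idealMr : forall x a, ideal_set x -> ideal_set (x ** a)
}.
Arguments ideal_closed {K A} c.

Section IdealAlgebra.
Variables (K : numFieldType) (A : banachAlgType K) (I : closed_ideal A).

Definition ideal_pred : pred A := fun x => x \in ideal_set I.

Lemma ideal_predP x : reflect (ideal_set I x) (x \in ideal_pred).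
Proof. by rewrite unfold_in; apply: (iffP idP); rewrite in_setE. Qed.

Lemma ideal_submod_closed : submod_closed ideal_pred.
Proof.
split; first exact/ideal_predP/ideal0.
by move=> k x y /ideal_predP Ix /ideal_predP Iy;
   apply/ideal_predP/idealD => //; exact: idealZ.
Qed.
HB.instance Definition _ :=
  GRing.isSubmodClosed.Build K A ideal_pred ideal_submod_closed.

Record ideal_alg := IdealElt {
  ideal_val :> A ;
  ideal_valP : ideal_val \in ideal_pred
}.
HB.instance Definition _ := [isSub for ideal_val].
HB.instance Definition _ := [Choice of ideal_alg by <:].
HB.instance Definition _ := [SubChoice_isSubLmodule of ideal_alg by <:].

Implicit Types x y : ideal_alg.

Lemma ideal_normD x y : `|\val (x + y)| <= `|\val x| + `|\val y| :> K.
Proof. by rewrite raddfD ler_normD. Qed.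
Lemma ideal_normZ (k : K) x : `|\val (k *: x)| = `|k| * `|\val x| :> K.
Proof. by rewrite linearZ normrZ. Qed.
Lemma ideal_norm0 x : `|\val x| = 0 :> K -> x = 0.
Proof. by move=> /normr0_eq0 x0; apply: val_inj; rewrite raddf0. Qed.

HB.instance Definition _ := @Lmodule_isNormed.Build K ideal_alg
  (fun x => `|\val x|) ideal_normD ideal_normZ ideal_norm0.

Lemma ideal_normE x : `|x| = `|\val x| :> K. Proof. by []. Qed.

Lemma ideal_ballE x y (e : K) : ball x e y = ball (\val x) e (\val y).
Proof. by rewrite -!ball_normE /= ideal_normE raddfB. Qed.

Lemma ideal_complete (F : set_system ideal_alg) :
  ProperFilter F -> cauchy F -> cvg F.
Proof.
move=> FF /cauchy_ballP Fc.
have : cauchy (\val @ F).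
  apply/cauchy_ballP => e e0.
  have [[P Q] /= [FP FQ] PQ] := Fc e e0.
  exists (\val @` P, \val @` Q) => /=.
    by split; [apply: filterS FP => x Px|apply: filterS FQ => x Px]; exists x.
  by move=> [_ _] /= [[x Px <-] [y Qy <-]]; rewrite -ideal_ballE; apply: (PQ (x, y)).
move=> /cauchy_cvg /cvg_ex [/= a Fa].
have Ia : a \in ideal_pred.
  apply/ideal_predP.
  apply: (@closed_cvg _ _ F _ \val (ideal_set I)) (Fa) => //.
    exact: ideal_closed.
  by apply: nearW => /= x; apply/ideal_predP; exact: ideal_valP.
apply/cvg_ex; exists (IdealElt Ia).
apply/cvg_ballP => e e0; have /cvg_ballP /(_ e e0) := Fa.
by apply: filterS => x; rewrite ideal_ballE.
Qed.
HB.instance Definition _ := Uniform_isComplete.Build ideal_alg ideal_complete.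

Lemma ideal_predMl a x : a ** \val x \in ideal_pred.
Proof. by apply/ideal_predP/idealMl/ideal_predP; exact: ideal_valP. Qed.
Lemma ideal_predMr x a : \val x ** a \in ideal_pred.
Proof. by apply/ideal_predP/idealMr/ideal_predP; exact: ideal_valP. Qed.

Definition ideal_lmul a x : ideal_alg := IdealElt (ideal_predMl a x).
Definition ideal_rmul x a : ideal_alg := IdealElt (ideal_predMr x a).
Definition ideal_mul x y : ideal_alg := ideal_lmul (\val x) y.

Fact ideal_mulA x y z :
  ideal_mul x (ideal_mul y z) = ideal_mul (ideal_mul x y) z.
Proof. by apply: val_inj; rewrite /= amulA. Qed.
Fact ideal_mulDl x y z :
  ideal_mul (x + y) z = ideal_mul x z + ideal_mul y z.
Proof. by apply: val_inj; rewrite /= amulDl. Qed.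
Fact ideal_mulDr x y z :
  ideal_mul x (y + z) = ideal_mul x y + ideal_mul x z.
Proof. by apply: val_inj; rewrite /= amulDr. Qed.
Fact ideal_mulZl (k : K) x y : ideal_mul (k *: x) y = k *: ideal_mul x y.
Proof. by apply: val_inj; rewrite /= amulZl. Qed.
Fact ideal_mulZr (k : K) x y : ideal_mul x (k *: y) = k *: ideal_mul x y.
Proof. by apply: val_inj; rewrite /= amulZr. Qed.
Fact ideal_norm_mul x y : `|ideal_mul x y| <= `|x| * `|y|.
Proof. exact: ler_norm_amul. Qed.

HB.instance Definition _ := @CompleteNormedModule_isBanachAlgebra.Build K
  ideal_alg ideal_mul ideal_mulA ideal_mulDl ideal_mulDr ideal_mulZl
  ideal_mulZr ideal_norm_mul.

Definition ideal_bimodule : banach_bimodule A.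
Proof.
refine (@BanachBimodule K A ideal_alg ideal_lmul ideal_rmul
          _ _ _ _ _ _ _ _ _ _ _ _ _).
all: try by move=> *; apply: val_inj;
  rewrite /= ?(amulDl, amulDr, amulZl, amulZr, amulA).
- by exists 1 => a x; rewrite mul1r; exact: ler_norm_amul.
- by exists 1 => x a; rewrite mul1r; exact: ler_norm_amul.
Defined.

End IdealAlgebra.

Section ComplexNorm.
Variable R : realType.

Lemma ge0_ReE (z : R[i]) : 0 <= z -> z = (complex.Re z)%:C.
Proof. by move=> z0; rewrite [LHS]complexE (ger0_Im z0) mulr0 addr0. Qed.

Lemma ler_Re (y z : R[i]) : y <= z -> complex.Re y <= complex.Re z.
Proof. by rewrite lecE => /andP[]. Qed.

Lemma normr_Re_ge0 (V : normedModType R[i]) (x : V) : 0 <= complex.Re `|x|.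
Proof. by rewrite -ler0c -ge0_ReE. Qed.

Lemma real_complexD (x y : R) : (x + y)%:C = x%:C + y%:C :> R[i].
Proof. exact: rmorphD. Qed.

Lemma real_complexM (x y : R) : (x * y)%:C = x%:C * y%:C :> R[i].
Proof. exact: rmorphM. Qed.

Lemma ge0_Re_ge0 (z : R[i]) : 0 <= z -> 0 <= complex.Re z.
Proof. by move=> z0; rewrite -ler0c -ge0_ReE. Qed.

Lemma ler_Re_norm (z : R[i]) : `|complex.Re z|%:C <= `|z|.
Proof.
rewrite normc_def lecR -sqrtr_sqr ler_sqrt ?lerDl ?sqr_ge0//.
by rewrite addr_ge0 ?sqr_ge0.
Qed.

Lemma ler_Im_norm (z : R[i]) : `|complex.Im z|%:C <= `|z|.
Proof.
rewrite normc_def lecR -sqrtr_sqr ler_sqrt ?lerDr ?sqr_ge0//.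
by rewrite addr_ge0 ?sqr_ge0.
Qed.

Lemma ler_norm_ReIm (z : R[i]) :
  `|z| <= (`|complex.Re z| + `|complex.Im z|)%:C.
Proof.
case: z => a b /=; have -> : a +i* b = a%:C + 'i * b%:C :> R[i].
  by rewrite [LHS]complexE.
rewrite (le_trans (ler_normD _ _))// normrM rmorphD /=.
have nR (c : R) : `|c%:C| = `|c|%:C :> R[i].
  by rewrite normc_def /= expr0n /= addr0 sqrtr_sqr.
have -> : `|'i : R[i]| = 1 by rewrite normc_def /= expr0n /= add0r expr1n sqrtr1.
by rewrite mul1r !nR.
Qed.

Lemma complex_cauchy_cvg (T : Type) (F : set_system T) (f : T -> R[i]) :
    ProperFilter F ->
    (forall e : R[i], 0 < e -> exists z, \forall t \near F, `|z - f t| < e) ->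
  exists z, forall e : R[i], 0 < e -> \forall t \near F, `|z - f t| < e.
Proof.
move=> FF Fc.
have part (p : R[i] -> R) : (forall y z, p (y - z) = p y - p z) ->
    (forall z, `|p z|%:C <= `|z|) -> cvg (p \o f @ F).
  move=> pB ple; apply: cauchy_cvg; apply/cauchyP => e e0.
  have [|z Fz] := Fc e%:C; first by rewrite ltcR.
  exists (p z); apply: filterS Fz => t zt.
  by rewrite -ball_normE /= -pB -ltcR (le_lt_trans (ple _)).
have ReB y z : @complex.Re R (y - z) = complex.Re y - complex.Re z.
  by case: y z => [? ?] [].
have ImB y z : @complex.Im R (y - z) = complex.Im y - complex.Im z.
  by case: y z => [? ?] [].
have /cvg_ex[/= a Fa] := part (@complex.Re R) ReB ler_Re_norm.
have /cvg_ex[/= b Fb] := part (@complex.Im R) ImB ler_Im_norm.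
exists (a +i* b) => e e0.
have eE := ge0_ReE (ltW e0).
have e20 : 0 < complex.Re e / 2 by rewrite divr_gt0// -ltcR -eE.
have /cvgrPdist_lt /(_ _ e20) Fa' := Fa.
have /cvgrPdist_lt /(_ _ e20) Fb' := Fb.
near=> t.
rewrite eE (le_lt_trans (ler_norm_ReIm _))// ltcR [ltRHS]splitr ltrD//.
  by near: t; apply: filterS Fa' => t; rewrite ReB.
by near: t; apply: filterS Fb' => t; rewrite ImB.
Unshelve. all: by end_near. Qed.

End ComplexNorm.

Section Dual.
Variables (R : realType) (V : normedModType R[i]).

(* Norms of normed modules over R[i] take values in R[i]; since they are
   nonnegative, Re maps them faithfully to R, where sup and inf are taken. *)
Record dual := Dual {
  dual_fun :> V -> R[i] ;
  dual_linear : scalar dual_fun ;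
  dual_bounded : exists M : R[i], forall x, `|dual_fun x| <= M * `|x|
}.

Lemma dual_ext (f g : dual) : (forall x, f x = g x) -> f = g.
Proof.
case: f g => [f fl fb] [g gl gb] /= /funext fg; subst g.
by rewrite (Prop_irrelevance fl gl) (Prop_irrelevance fb gb).
Qed.

HB.instance Definition _ := gen_eqMixin dual.
HB.instance Definition _ := gen_choiceMixin dual.

Implicit Types f g : dual.

HB.instance Definition _ f :=
  GRing.isLinear.Build R[i] V R[i] *%R (dual_fun f) (@dual_linear f).

Lemma ler_normM (y M t : R[i]) : 0 <= y -> 0 <= t -> y <= M * t -> y <= `|M| * t.
Proof.
move=> y0 t0 yM; rewrite -[t in leRHS]ger0_norm// -normrM ger0_norm//.
exact: le_trans yM.
Qed.

Lemma dual_boundedP f :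
  exists2 M : R, 0 <= M & forall x, `|f x| <= M%:C * `|x|.
Proof.
have [M fM] := dual_bounded f.
exists (complex.Re `|M|).
  by rewrite -ler0c -ge0_ReE.
by move=> x; rewrite -ge0_ReE// ler_normM.
Qed.

Program Definition dual_zero : dual := @Dual (fun=> 0) _ _.
Next Obligation. by move=> k x y; rewrite mulr0 addr0. Qed.
Next Obligation. by exists 0 => x; rewrite normr0 mul0r. Qed.

Program Definition dual_add f g : dual := @Dual (fun x => f x + g x) _ _.
Next Obligation.
by move=> f g k x y; rewrite !linearP mulrDr addrACA.
Qed.
Next Obligation.
move=> f g; have [M _ fM] := dual_boundedP f; have [N _ gN] := dual_boundedP g.
by exists (M%:C + N%:C) => x; rewrite mulrDl (le_trans (ler_normD _ _))// lerD.
Qed.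

Program Definition dual_scale (k : R[i]) f : dual := @Dual (fun x => k * f x) _ _.
Next Obligation. by move=> k f l x y; rewrite !linearP mulrDr mulrCA. Qed.
Next Obligation.
move=> k f; have [M _ fM] := dual_boundedP f.
by exists (`|k| * M%:C) => x; rewrite normrM -mulrA ler_wpM2l.
Qed.

Definition dual_opp f : dual := dual_scale (-1) f.

Fact dual_addA : associative dual_add.
Proof. by move=> f g h; apply: dual_ext => x /=; rewrite addrA. Qed.
Fact dual_addC : commutative dual_add.
Proof. by move=> f g; apply: dual_ext => x /=; rewrite addrC. Qed.
Fact dual_add0 : left_id dual_zero dual_add.
Proof. by move=> f; apply: dual_ext => x /=; rewrite add0r. Qed.
Fact dual_addN : left_inverse dual_zero dual_opp dual_add.
Proof. by move=> f; apply: dual_ext => x /=; rewrite mulN1r addNr. Qed.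
HB.instance Definition _ :=
  GRing.isZmodule.Build dual dual_addA dual_addC dual_add0 dual_addN.

Fact dual_scaleA k l f : dual_scale k (dual_scale l f) = dual_scale (k * l) f.
Proof. by apply: dual_ext => x /=; rewrite mulrA. Qed.
Fact dual_scale1 : left_id 1 dual_scale.
Proof. by move=> f; apply: dual_ext => x /=; rewrite mul1r. Qed.
Fact dual_scaleDr : right_distributive dual_scale +%R.
Proof. by move=> k f g; apply: dual_ext => x /=; rewrite mulrDr. Qed.
Fact dual_scaleDl f : {morph dual_scale^~ f : k l / k + l}.
Proof. by move=> k l; apply: dual_ext => x /=; rewrite mulrDl. Qed.
HB.instance Definition _ := GRing.Zmodule_isLmodule.Build R[i] dual
  dual_scaleA dual_scale1 dual_scaleDr dual_scaleDl.

Lemma dualDE f g x : (f + g) x = f x + g x. Proof. by []. Qed.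
Lemma dualZE k f x : (k *: f) x = k * f x. Proof. by []. Qed.
Lemma dualNE f x : (- f) x = - f x. Proof. by rewrite -mulN1r. Qed.
Lemma dualBE f g x : (f - g) x = f x - g x.
Proof. by rewrite dualDE dualNE. Qed.
Lemma dual0E x : (0 : dual) x = 0. Proof. by []. Qed.

Definition dual_norm f : R :=
  sup [set complex.Re `|f x| | x in [set x | `|x| <= 1]].

Let has_sup_dual_norm f :
  has_sup [set complex.Re `|f x| | x in [set x | `|x| <= 1]].
Proof.
split; first by exists (complex.Re `|f 0|), 0 => //=; rewrite normr0.
have [M M0 fM] := dual_boundedP f.
exists M => _ [x /= x1 <-]; have := ler_Re (fM x) => /le_trans; apply.
rewrite -[leRHS]/(complex.Re M%:C); apply: ler_Re.
by rewrite -[leRHS]mulr1 ler_wpM2l// ler0c.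
Qed.

Lemma dual_norm_ge0 f : 0 <= dual_norm f.
Proof.
have -> : 0 = complex.Re `|f 0| by rewrite linear0 normr0.
apply: sup_upper_bound (has_sup_dual_norm f) _ _.
by exists 0 => //=; rewrite normr0.
Qed.

Lemma dual_norm_ub f x : `|f x| <= (dual_norm f)%:C * `|x|.
Proof.
have [->|x0] := eqVneq x 0; first by rewrite linear0 !normr0 mulr0.
have nx : 0 < `|x| by rewrite normr_gt0.
rewrite -ler_pdivrMr// -[`|x|]ger0_norm// -normfV -normrM mulrC.
rewrite -[_ * f x]linearZ [leLHS]ge0_ReE// lecR.
apply: sup_upper_bound (has_sup_dual_norm f) _ _.
by exists (`|x|^-1 *: x) => //=; rewrite normfZV.
Qed.

Lemma dual_norm_lub f (M : R) : 0 <= M ->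
  (forall x, `|f x| <= M%:C * `|x|) -> dual_norm f <= M.
Proof.
move=> M0 fM; apply: ge_sup; first exact: (has_sup_dual_norm f).1.
move=> _ [x /= x1 <-]; have := ler_Re (fM x) => /le_trans; apply.
rewrite -[leRHS]/(complex.Re M%:C); apply: ler_Re.
by rewrite -[leRHS]mulr1 ler_wpM2l// ler0c.
Qed.

Let dual_normCD f g :
  (dual_norm (f + g))%:C <= (dual_norm f)%:C + (dual_norm g)%:C.
Proof.
rewrite -real_complexD lecR; apply: dual_norm_lub => [|x].
  by rewrite addr_ge0 ?dual_norm_ge0.
by rewrite real_complexD mulrDl (le_trans (ler_normD _ _))// lerD// dual_norm_ub.
Qed.

Let dual_norm_scale_le k f : dual_norm (k *: f) <= complex.Re `|k| * dual_norm f.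
Proof.
apply: dual_norm_lub => [|x].
  by rewrite mulr_ge0 ?dual_norm_ge0// ge0_Re_ge0.
by rewrite real_complexM -ge0_ReE// normrM -mulrA ler_wpM2l// dual_norm_ub.
Qed.

Let dual_normCZ (k : R[i]) f : (dual_norm (k *: f))%:C = `|k| * (dual_norm f)%:C.
Proof.
rewrite [`|k|]ge0_ReE// -real_complexM; congr (_%:C); apply/eqP.
rewrite eq_le dual_norm_scale_le andTb.
have [->|k0] := eqVneq k 0; first by rewrite normr0 mul0r dual_norm_ge0.
have k0' : 0 < complex.Re `|k| by rewrite -ltcR -ge0_ReE// normr_gt0.
rewrite -[in leLHS](scalerK k0 f) mulrC -ler_pdivlMr//.
rewrite (le_trans (dual_norm_scale_le _ _))// mulrC ler_wpM2l ?dual_norm_ge0//.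
by rewrite -lecR -ge0_ReE// normfV {1}[`|k|]ge0_ReE// -fmorphV.
Qed.

Let dual_normC0 f : (dual_norm f)%:C = 0 -> f = 0.
Proof.
move=> f0; apply: dual_ext => x; apply/eqP; rewrite -normr_le0.
by rewrite (le_trans (dual_norm_ub f x))// f0 mul0r.
Qed.

HB.instance Definition _ := @Lmodule_isNormed.Build R[i] dual
  (fun f => (dual_norm f)%:C) dual_normCD dual_normCZ dual_normC0.

Lemma dual_normE f : `|f| = (dual_norm f)%:C. Proof. by []. Qed.

Lemma ler_dual_norm f x : `|f x| <= `|f| * `|x|.
Proof. exact: dual_norm_ub. Qed.

Lemma dual_norm_le f (M : R[i]) : 0 <= M ->
  (forall x, `|f x| <= M * `|x|) -> `|f| <= M.
Proof.
move=> M0; rewrite (ge0_ReE M0) => fM; rewrite dual_normE lecR.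
by apply: dual_norm_lub => //; rewrite -ler0c -ge0_ReE.
Qed.

Lemma dual_complete (F : set_system dual) : ProperFilter F -> cauchy F -> cvg F.
Proof.
move=> FF Fc.
have Fb : forall e : R[i], 0 < e ->
    exists2 f0, F [set f | `|f0 - f| < e] & \forall f & g \near F, `|f - g| < e.
  move=> e e0; have /cauchyP /(_ e e0) [f0 Ff0] := Fc.
  exists f0; first by move: Ff0; rewrite -ball_normE.
  have /cauchy_ballP /(_ e e0) := Fc.
  by rewrite near2E; apply: filterS => -[f g] /=; rewrite -ball_normE.
have lim (x : V) : exists z : R[i], forall e : R[i], 0 < e -> \forall f \near F, `|z - dual_fun f x| < e.
  apply: complex_cauchy_cvg => e e0.
  have e0' : 0 < e / (1 + `|x|) by rewrite divr_gt0// ltr_wpDr.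
  have [f0 Ff0 _] := Fb _ e0'; exists (f0 x).
  apply: filterS Ff0 => f /= ff0; rewrite -dualBE.
  rewrite (le_lt_trans (ler_dual_norm _ _))//.
  have x1 : 0 < 1 + `|x| by rewrite ltr_wpDr.
  rewrite (@le_lt_trans _ _ (`|f0 - f| * (1 + `|x|)))//.
    by rewrite ler_wpM2l// lerDr.
  by rewrite -ltr_pdivlMr.
have [l Fl] := choice lim.
have eq_lim (y z : R[i]) : (forall e : R[i], 0 < e -> `|y - z| <= e) -> y = z.
  move=> yz; apply/eqP; rewrite -subr_eq0 -normr_le0; apply/ler_addgt0Pl.
  by move=> e e0; rewrite addr0 yz.
have l_lin : scalar l.
  move=> k x y; apply: eq_lim => e e0.
  have e30 : 0 < e / 3 / (1 + `|k|) by rewrite !divr_gt0// ltr_wpDr.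
  near F => f.
  have -> : l (k *: x + y) - (k * l x + l y) =
      (l (k *: x + y) - f (k *: x + y)) - k * (l x - f x) - (l y - f y).
    have -> : f (k *: x + y) = k * f x + f y by exact: dual_linear.
    by ring.
  have k1 : 1 <= 1 + `|k| by rewrite lerDl.
  have k1' : 0 < 1 + `|k| by rewrite ltr_wpDr.
  have e3 : e / 3 / (1 + `|k|) <= e / 3.
    by rewrite ler_pdivrMr// ler_peMr// divr_ge0// ltW.
  have -> : e = e / 3 + e / 3 + e / 3 by field.
  rewrite (le_trans (ler_normB _ _))// lerD//; last first.
    rewrite (le_trans _ e3)//; apply: ltW; near: f; exact: Fl.
  rewrite (le_trans (ler_normB _ _))// lerD//.
    rewrite (le_trans _ e3)//; apply: ltW; near: f; exact: Fl.
  rewrite normrM (@le_trans _ _ ((1 + `|k|) * `|l x - f x|))//.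
    by rewrite ler_wpM2r// lerDr.
  rewrite mulrC -ler_pdivlMr//; apply: ltW; near: f; exact: Fl.
have l_close (e : R[i]) f0 : 0 < e -> F [set f | `|f0 - f| < e] ->
    forall x, `|l x - f0 x| <= e * `|x|.
  move=> e0 Ff0 x; apply/ler_addgt0Pl => d d0.
  near F => f.
  have -> : l x - f0 x = (l x - f x) - (f0 - f) x by rewrite dualBE; ring.
  rewrite (le_trans (ler_normB _ _))// lerD//.
    by apply: ltW; near: f; exact: Fl.
  rewrite (le_trans (ler_dual_norm _ _))// ler_wpM2r// ltW//.
  by near: f.
have l_bnd : exists M : R[i], forall x, `|l x| <= M * `|x|.
  have [f0 Ff0 _] := Fb 1 ltr01.
  exists (1 + `|f0|) => x; rewrite mulrDl.
  rewrite -[l x](subrK (f0 x)) (le_trans (ler_normD _ _))// lerD//.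
    exact: l_close.
  exact: ler_dual_norm.
apply/cvg_ex; exists (Dual l_lin l_bnd).
apply/cvgrPdist_le => e e0.
have [f0 Ff0 Fe] := Fb _ e0.
move/nearP_dep : Fe; apply: filterS => g Fg.
apply: dual_norm_le; first exact: ltW.
move=> x; rewrite dualBE /=; apply: l_close => //.
Unshelve. all: by end_near. Qed.

HB.instance Definition _ := Uniform_isComplete.Build dual dual_complete.

End Dual.

Section DualBimodule.
Variables (R : realType) (A : banachAlgType R[i]) (X : banach_bimodule A).

Program Definition dual_lact (a : A) (f : dual X) : dual X :=
  @Dual R X (fun x => f (ract x a)) _ _.
Next Obligation. by move=> a f k x y; rewrite ractDl ractZl linearP. Qed.
Next Obligation.
move=> a f; have [M XM] := ract_bounded X.
exists (`|f| * (`|M| * `|a|)) => x; rewrite (le_trans (ler_dual_norm _ _))//.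
rewrite -mulrA ler_wpM2l// -mulrA [_ * `|x|]mulrC ler_normM ?mulr_ge0//.
Qed.

Program Definition dual_ract (f : dual X) (a : A) : dual X :=
  @Dual R X (fun x => f (lact a x)) _ _.
Next Obligation. by move=> f a k x y; rewrite lactDr lactZr linearP. Qed.
Next Obligation.
move=> f a; have [M XM] := lact_bounded X.
exists (`|f| * (`|M| * `|a|)) => x; rewrite (le_trans (ler_dual_norm _ _))//.
rewrite -mulrA ler_wpM2l// -mulrA ler_normM ?mulr_ge0//.
Qed.

Definition dual_bimodule : banach_bimodule A.
Proof.
refine (@BanachBimodule _ A (dual X) dual_lact dual_ract
          _ _ _ _ _ _ _ _ _ _ _ _ _).
- by move=> a b f; apply: dual_ext => x; rewrite /= ractDr linearD.
- by move=> a f g; apply: dual_ext => x.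
- by move=> k a f; apply: dual_ext => x; rewrite /= ractZr linearZ.
- by move=> k a f; apply: dual_ext => x.
- by move=> f g a; apply: dual_ext => x.
- by move=> f a b; apply: dual_ext => x; rewrite /= lactDl linearD.
- by move=> k f a; apply: dual_ext => x.
- by move=> k f a; apply: dual_ext => x; rewrite /= lactZl linearZ.
- by move=> a b f; apply: dual_ext => x; rewrite /= ractA.
- by move=> f a b; apply: dual_ext => x; rewrite /= lactA.
- by move=> a f b; apply: dual_ext => x; rewrite /= lractA.
- have [M XM] := ract_bounded X; exists `|M| => a f.
  apply: dual_norm_le => [|x]; first by rewrite !mulr_ge0.
  rewrite -[dual_lact a f x]/(f (ract x a)) (le_trans (ler_dual_norm _ _))//.
  rewrite [`|a| * _]mulrC mulrCA -!mulrA.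
  rewrite ler_wpM2l// [`|a| * _]mulrC ler_normM ?mulr_ge0//.
- have [M XM] := lact_bounded X; exists `|M| => f a.
  apply: dual_norm_le => [|x]; first by rewrite !mulr_ge0.
  rewrite -[dual_ract f a x]/(f (lact a x)) (le_trans (ler_dual_norm _ _))//.
  rewrite mulrCA -!mulrA.
  rewrite ler_wpM2l// ler_normM ?mulr_ge0//.
Defined.

End DualBimodule.

Section QuotientAlgebra.
Variables (R : realType) (A : banachAlgType R[i]) (I : closed_ideal A).
Local Open Scope quotient_scope.

Definition quotient_alg :=
  Quotient.quot (GRing.ZmodClosed.clone A (ideal_pred I) _).
HB.instance Definition _ := GRing.Zmodule.on quotient_alg.

HB.instance Definition _ := EqQuotient.on quotient_alg.

Definition quotient_proj (a : A) : quotient_alg := \pi_quotient_alg a.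
Local Notation q := quotient_proj.

Implicit Types x y : quotient_alg.

Lemma quotient_projE a b : (q a = q b) <-> ideal_set I (a - b).
Proof.
split=> [/eqP ab|ab]; last apply/eqP.
  by apply/ideal_predP; rewrite Quotient.idealrBE.
by rewrite -[_ == _]Quotient.idealrBE; apply/ideal_predP.
Qed.

Lemma quotient_projD a b : q (a + b) = q a + q b.
Proof. exact: pi_addr. Qed.

Lemma quotient_surj x : exists a, q a = x.
Proof. by exists (repr x); exact: reprK. Qed.

Definition quotient_scale (k : R[i]) x : quotient_alg := q (k *: repr (x)).
Definition quotient_mul x y : quotient_alg :=
  q (repr (x) ** repr (y)).

Lemma repr_projB a : ideal_set I (repr (q a) - a).
Proof. by apply/quotient_projE; exact: reprK. Qed.

Lemma quotient_scaleE k a : quotient_scale k (q a) = q (k *: a).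
Proof.
by apply/quotient_projE; rewrite -scalerBr; apply/idealZ/repr_projB.
Qed.

Lemma quotient_mulE a b : quotient_mul (q a) (q b) = q (a ** b).
Proof.
apply/quotient_projE; set a' := repr _; set b' := repr _.
have -> : a' ** b' - a ** b = (a' - a) ** b' + a ** (b' - b).
  by rewrite amulBl amulBr addrA subrK.
by apply: idealD; [apply/idealMr/repr_projB|apply/idealMl/repr_projB].
Qed.

Fact quotient_scaleA k l x :
  quotient_scale k (quotient_scale l x) = quotient_scale (k * l) x.
Proof. by have [a <-] := quotient_surj x; rewrite !quotient_scaleE scalerA. Qed.
Fact quotient_scale1 : left_id 1 quotient_scale.
Proof. by move=> x; have [a <-] := quotient_surj x; rewrite quotient_scaleE scale1r. Qed.
Fact quotient_scaleDr : right_distributive quotient_scale +%R.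
Proof.
move=> k x y; have [a <-] := quotient_surj x; have [b <-] := quotient_surj y.
by rewrite -quotient_projD !quotient_scaleE scalerDr quotient_projD.
Qed.
Fact quotient_scaleDl x : {morph quotient_scale^~ x : k l / k + l}.
Proof.
move=> k l; have [a <-] := quotient_surj x.
by rewrite !quotient_scaleE scalerDl quotient_projD.
Qed.
HB.instance Definition _ := GRing.Zmodule_isLmodule.Build R[i] quotient_alg
  quotient_scaleA quotient_scale1 quotient_scaleDr quotient_scaleDl.

Lemma quotient_projZ k a : q (k *: a) = k *: q a.
Proof. by rewrite -quotient_scaleE. Qed.

Fact quotient_proj_linear : linear q.
Proof. by move=> k a b; rewrite quotient_projD quotient_projZ. Qed.
HB.instance Definition _ :=
  GRing.isLinear.Build R[i] A quotient_alg *:%R q quotient_proj_linear.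

Definition quotient_norm x : R := inf [set complex.Re `|a| | a in [set a | q a = x]].

Let has_inf_quotient_norm x :
  has_inf [set complex.Re `|a| | a in [set a | q a = x]].
Proof.
split; first by have [a ax] := quotient_surj x; exists (complex.Re `|a|), a.
by exists 0 => _ [a _ <-]; exact: normr_Re_ge0.
Qed.

Lemma quotient_norm_ge0 x : 0 <= quotient_norm x.
Proof.
apply: lb_le_inf; first exact: (has_inf_quotient_norm x).1.
by move=> _ [a _ <-]; exact: normr_Re_ge0.
Qed.

Lemma quotient_norm_proj a : quotient_norm (q a) <= complex.Re `|a|.
Proof. by apply: ge_inf (has_inf_quotient_norm _).2 _ _; exists a. Qed.

Lemma quotient_norm_lift x (e : R) : 0 < e ->
  exists2 a, q a = x & complex.Re `|a| < quotient_norm x + e.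
Proof.
move=> e0; have [_ [a ax <-] ae] := inf_adherent e0 (has_inf_quotient_norm x).
by exists a.
Qed.

Lemma Re_normD (V : normedModType R[i]) (a b : V) :
  complex.Re `|a + b| <= complex.Re `|a| + complex.Re `|b|.
Proof. by rewrite -lecR real_complexD -!ge0_ReE// ler_normD. Qed.

Let quotient_normD x y : quotient_norm (x + y) <= quotient_norm x + quotient_norm y.
Proof.
apply/ler_addgt0Pl => e e0.
have e20 : 0 < e / 2 by rewrite divr_gt0.
have [a ax ae] := quotient_norm_lift x e20.
have [b bx be] := quotient_norm_lift y e20.
rewrite -ax -bx -quotient_projD (le_trans (quotient_norm_proj _))//.
rewrite (le_trans (Re_normD _ _))// (le_trans (lerD (ltW ae) (ltW be)))//.
by rewrite addrACA -splitr addrC ax bx.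
Qed.

Let quotient_norm_scale_le k x :
  quotient_norm (k *: x) <= complex.Re `|k| * quotient_norm x.
Proof.
apply/ler_addgt0Pl => e e0.
have k1 : 0 < complex.Re `|k| + 1 by rewrite ltr_wpDl// ge0_Re_ge0.
have e20 : 0 < e / (complex.Re `|k| + 1) by rewrite divr_gt0.
have [a <- ae] := quotient_norm_lift x e20.
rewrite -quotient_projZ (le_trans (quotient_norm_proj _))//.
rewrite normrZ [`|k|]ge0_ReE// [`|a|]ge0_ReE// -real_complexM.
rewrite -[leLHS]/(complex.Re `|k| * complex.Re `|a|).
rewrite (le_trans (ler_wpM2l _ (ltW ae))) ?ge0_Re_ge0// mulrDr addrC lerD2r.
rewrite mulrCA ger_pMr// ler_pdivrMr// mul1r lerDl//.
Qed.

Let quotient_normCD x y :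
  (quotient_norm (x + y))%:C <= (quotient_norm x)%:C + (quotient_norm y)%:C.
Proof. by rewrite -real_complexD lecR quotient_normD. Qed.

Let quotient_normCZ (k : R[i]) x :
  (quotient_norm (k *: x))%:C = `|k| * (quotient_norm x)%:C.
Proof.
rewrite [`|k|]ge0_ReE// -real_complexM; congr (_%:C); apply/eqP.
rewrite eq_le quotient_norm_scale_le andTb.
have [->|k0] := eqVneq k 0; first by rewrite normr0 mul0r quotient_norm_ge0.
have k0' : 0 < complex.Re `|k| by rewrite -ltcR -ge0_ReE// normr_gt0.
rewrite -[in leLHS](scalerK k0 x) mulrC -ler_pdivlMr//.
rewrite (le_trans (quotient_norm_scale_le _ _))// mulrC.
rewrite ler_wpM2l ?quotient_norm_ge0//.
by rewrite -lecR -ge0_ReE// normfV {1}[`|k|]ge0_ReE// -fmorphV.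
Qed.

Let quotient_normC0 x : (quotient_norm x)%:C = 0 -> x = 0.
Proof.
move=> /complexI x0; have [a ax] := quotient_surj x; rewrite -ax.
have <- : q 0 = 0 by rewrite -(subrr 0) linearB subrr.
apply/quotient_projE; rewrite subr0.
have -> := (closure_id (ideal_set I)).1 (ideal_closed I).
move=> U /nbhs_ballP[e /= e0 aeU].
have e0' : 0 < complex.Re e by rewrite -ltcR -ge0_ReE ?ltW.
have [b bx be] := quotient_norm_lift x e0'.
exists (a - b); split; first by apply/quotient_projE; rewrite ax bx.
apply: aeU; rewrite -ball_normE /= subKr [ltLHS]ge0_ReE// (ge0_ReE (ltW e0)).
by rewrite ltcR -[ltRHS]add0r -x0.
Qed.

HB.instance Definition _ := @Lmodule_isNormed.Build R[i] quotient_alg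
  (fun x => (quotient_norm x)%:C) quotient_normCD quotient_normCZ
  quotient_normC0.

Lemma quotient_normE x : `|x| = (quotient_norm x)%:C. Proof. by []. Qed.

Lemma ler_quotient_proj a : `|q a| <= `|a|.
Proof. by rewrite quotient_normE [leRHS]ge0_ReE// lecR quotient_norm_proj. Qed.

Let exists_expr (e : R) : 0 < e -> \forall n \near \oo, 2^-1 ^+ n < e.
Proof.
move=> e0; have h : `|2^-1 : R| < 1.
  by rewrite ger0_norm ?invr_ge0// invf_lt1// ltr1n.
have /cvgrPdist_lt/(_ _ e0) := cvg_expr h.
by apply: filterS => n; rewrite sub0r normrN ger0_norm// exprn_ge0// invr_ge0.
Qed.

Lemma quotient_complete (F : set_system quotient_alg) :
  ProperFilter F -> cauchy F -> cvg F.
Proof.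
move=> FF /cauchyP Fc.
pose w n : R := 2^-1 ^+ n.
have w0 n : 0 < w n by rewrite exprn_gt0// invr_gt0.
have wS n : w n = w n.+1 + w n.+1 by rewrite /w exprS mulrC -splitr.
have wle n : w n.+1 <= w n by rewrite [leRHS]wS lerDr ltW.
have /choice[u Fu] n : exists x, F [set y | quotient_norm (x - y) < w n].
  have [|x Fx] := Fc (w n)%:C; first by rewrite ltcR.
  by exists x; apply: filterS Fx => y; rewrite -ball_normE /= -ltcR.
have uS n : quotient_norm (u n.+1 - u n) < 2 * w n.
  near F => y.
  have -> : u n.+1 - u n = (u n.+1 - y) + -1 *: (u n - y).
    by rewrite scaleN1r opprB addrA subrK.
  rewrite (le_lt_trans (quotient_normD _ _))// mulr_natl mulr2n ltrD//.
    by rewrite (lt_le_trans _ (wle n))//; near: y; exact: Fu.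
  rewrite (le_lt_trans (quotient_norm_scale_le _ _))//.
  rewrite normrN normr1 -[complex.Re 1]/(1 : R) mul1r.
  by near: y; exact: Fu.
have /choice[g gP] (na : nat * A) : exists b, q na.2 = u na.1 ->
    q b = u na.1.+1 /\ complex.Re `|b - na.2| < 2 * w na.1.
  case: na => n a /=; have := uS n; rewrite -subr_gt0.
  move=> /(quotient_norm_lift (u n.+1 - u n)) [c cu clt].
  exists (c + a) => qa; split; first by rewrite quotient_projD cu qa subrK.
  by rewrite addrK (lt_le_trans clt)// subrKC.
have [a0 qa0] := quotient_surj (u 0%N).
pose s := fix s n := if n is m.+1 then g (m, s m) else a0.
have qs n : q (s n) = u n.
  by elim: n => // n IHn; have [] := gP (n, s n) IHn.
have sS n : complex.Re `|s n.+1 - s n| < 2 * w n.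
  by have [] := gP (n, s n) (qs n).
have sD n k : complex.Re `|s (n + k)%N - s n| <= 4 * w n - 4 * w (n + k)%N.
  elim: k => [|k IHk]; first by rewrite addn0 !subrr normr0.
  rewrite addnS -[s (n + k).+1](subrK (s (n + k)%N)) -addrA.
  rewrite (le_trans (Re_normD _ _))//.
  rewrite (le_trans (lerD (ltW (sS _)) IHk))//.
  by rewrite [w (n + k)%N in X in X <= _]wS; lra.
have : cauchy (s @ \oo).
  apply/cauchyP => e e0.
  have e0' : 0 < complex.Re e / 4 by rewrite divr_gt0// -ltcR -ge0_ReE ?ltW.
  have [n _ /(_ n (leqnn n)) /= ne] := exists_expr e0'.
  exists (s n); exists n => // m /= nm.
  rewrite -ball_normE /= distrC (ge0_ReE (ltW e0)) [ltLHS]ge0_ReE// ltcR.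
  rewrite -(subnKC nm) (le_lt_trans (sD _ _))//.
  have := w0 (n + (m - n))%N; move: ne; rewrite -/(w n) ltr_pdivlMr//.
  lra.
move=> /cauchy_cvg /cvg_ex[/= a sa].
apply/cvg_ex; exists (q a); apply/cvgrPdist_lt => e e0.
have e20 : 0 < e / 2 by rewrite divr_gt0.
have e20' : 0 < complex.Re (e / 2) by rewrite -ltcR -ge0_ReE ?ltW.
have /cvgrPdist_lt/(_ _ e20) sae := sa.
near \oo => n.
apply: filterS (Fu n) => y uy.
rewrite -(subrK (u n) (q a)) -addrA (le_lt_trans (ler_normD _ _))//.
rewrite [ltRHS]splitr ltrD//.
  rewrite -qs -linearB (le_lt_trans (ler_quotient_proj _))//.
  by near: n.
rewrite quotient_normE (ge0_ReE (ltW e20)) ltcR (lt_trans uy)//.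
by near: n; exact: exists_expr.
Unshelve. all: by end_near. Qed.

HB.instance Definition _ := Uniform_isComplete.Build quotient_alg quotient_complete.

Fact quotient_mulA x y z :
  quotient_mul x (quotient_mul y z) = quotient_mul (quotient_mul x y) z.
Proof.
have [a <-] := quotient_surj x; have [b <-] := quotient_surj y.
by have [c <-] := quotient_surj z; rewrite !quotient_mulE amulA.
Qed.
Fact quotient_mulDl x y z :
  quotient_mul (x + y) z = quotient_mul x z + quotient_mul y z.
Proof.
have [a <-] := quotient_surj x; have [b <-] := quotient_surj y.
have [c <-] := quotient_surj z.
by rewrite -quotient_projD !quotient_mulE amulDl quotient_projD.
Qed.
Fact quotient_mulDr x y z :
  quotient_mul x (y + z) = quotient_mul x y + quotient_mul x z.
Proof.
have [a <-] := quotient_surj x; have [b <-] := quotient_surj y.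
have [c <-] := quotient_surj z.
by rewrite -quotient_projD !quotient_mulE amulDr quotient_projD.
Qed.
Fact quotient_mulZl (k : R[i]) x y :
  quotient_mul (k *: x) y = k *: quotient_mul x y.
Proof.
have [a <-] := quotient_surj x; have [b <-] := quotient_surj y.
by rewrite -quotient_projZ !quotient_mulE amulZl quotient_projZ.
Qed.
Fact quotient_mulZr (k : R[i]) x y :
  quotient_mul x (k *: y) = k *: quotient_mul x y.
Proof.
have [a <-] := quotient_surj x; have [b <-] := quotient_surj y.
by rewrite -quotient_projZ !quotient_mulE amulZr quotient_projZ.
Qed.
Fact quotient_norm_mul x y : `|quotient_mul x y| <= `|x| * `|y|.
Proof.
rewrite !quotient_normE -real_complexM lecR; apply/ler_addgt0Pl => e e0.
pose M := quotient_norm x + quotient_norm y + 1.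
have M0 : 0 < M by rewrite ltr_wpDl// addr_ge0 ?quotient_norm_ge0.
pose d := Num.min 1 (e / M).
have d0 : 0 < d by rewrite lt_min ltr01 divr_gt0.
have [a ax ae] := quotient_norm_lift x d0.
have [b bx be] := quotient_norm_lift y d0.
rewrite -[in leLHS]ax -[in leLHS]bx quotient_mulE.
rewrite (le_trans (quotient_norm_proj _))//.
have := ler_norm_amul a b.
rewrite [leLHS]ge0_ReE// [`|a|]ge0_ReE// [`|b|]ge0_ReE// -real_complexM lecR.
move=> /le_trans; apply.
rewrite (@le_trans _ _ ((quotient_norm x + d) * (quotient_norm y + d)))//.
  by rewrite ler_pM// ?normr_Re_ge0// ltW.
have dM : d * M <= e by rewrite -ler_pdivlMr// ge_min lexx orbT.
have d1 : d * d <= d by rewrite ger_pMr// ge_min lexx.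
move: dM; rewrite /M; nra.
Qed.

HB.instance Definition _ := @CompleteNormedModule_isBanachAlgebra.Build R[i]
  quotient_alg quotient_mul quotient_mulA quotient_mulDl quotient_mulDr
  quotient_mulZl quotient_mulZr quotient_norm_mul.

End QuotientAlgebra.

Record directed_set := DirectedSet {
  directed_sort :> Type ;
  directed_le : directed_sort -> directed_sort -> Prop ;
  directed_inh : inhabited directed_sort ;
  directed_refl : forall i, directed_le i i ;
  directed_trans :
    forall i j k, directed_le i j -> directed_le j k -> directed_le i k ;
  directed_ub : forall i j, exists k, directed_le i k /\ directed_le j k
}.

(* A net x : J -> T converges to l iff x @ tails J --> l. *)
Definition tails (J : directed_set) : set_system J :=
  [set S | exists i, forall j, directed_le i j -> S j].
Arguments tails : clear implicits.

Lemma tails_proper_filter (J : directed_set) : ProperFilter (tails J).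
Proof.
split=> [[i /(_ i (directed_refl i))]//|]; split.
- by have [k] := directed_inh J; exists k.
- move=> P Q [i iP] [j jQ]; have [k [ik jk]] := directed_ub i j.
  by exists k => l kl; split;
    [apply/iP/directed_trans/kl|apply/jQ/directed_trans/kl].
- by move=> P Q PQ [i iP]; exists i => j /iP /PQ.
Qed.
#[global] Existing Instance tails_proper_filter.

Section Amenability.
Variable R : realType.
Implicit Types A : banachAlgType R[i].

Definition bounded_operator (V W : normedModType R[i]) (D : V -> W) :=
  exists M : R[i], forall v, `|D v| <= M * `|v|.

Definition derivation A (X : banach_bimodule A) (D : {linear A -> X}) :=
  forall a b, D (a ** b) = lact a (D b) + ract (D a) b.

Definition inner A (X : banach_bimodule A) (D : {linear A -> X}) :=
  exists x : X, forall a, D a = lact a x - ract x a.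

Definition approximately_inner A (X : banach_bimodule A)
    (D : {linear A -> X}) :=
  exists (J : directed_set) (x : J -> X),
    forall a, lact a (x j) - ract (x j) a @[j --> tails J] --> D a.

Definition weakly_amenable A :=
  forall D : {linear A -> dual_bimodule (regular_bimodule A)},
    bounded_operator D -> derivation D -> inner D.

Definition approximately_weakly_amenable A :=
  forall D : {linear A -> dual_bimodule (regular_bimodule A)},
    bounded_operator D -> derivation D -> approximately_inner D.

Definition approximate_trace_extension A (I : closed_ideal A) :=
  forall lambda : dual (ideal_bimodule I),
    (forall a : A, dual_lact a lambda = dual_ract lambda a) ->
  exists (J : directed_set) (L : J -> dual (regular_bimodule A)),
    (forall j (x : ideal_alg I), L j (ideal_val x) = lambda x) /\
    (forall a : A,
       dual_lact a (L j) - dual_ract (L j) a @[j --> tails J] --> 0).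

Definition bounded_approximate_identity A (J : directed_set) (e : J -> A) :=
  (exists M : R[i], forall j, `|e j| <= M) /\
  (forall a : A, e j ** a @[j --> tails J] --> a /\
                 a ** e j @[j --> tails J] --> a).

Definition quasi_central A (I : closed_ideal A) (J : directed_set)
    (e : J -> ideal_alg I) :=
  forall a : A,
    a ** ideal_val (e j) - ideal_val (e j) ** a @[j --> tails J] --> 0.

End Amenability.

(* Main.v *)
(* Parts (i)-(iii) rest on one translation: a bounded derivation D from A into
   its dual that vanishes on I in either variable is the same thing as a bounded
   derivation of A/I into its dual, and inflation along A -> A/I is isometric
   on duals.
   (i) If lambda is a trace on I and L0 a Hahn-Banach extension of it, the inner
   derivation of L0 descends to A/I; approximating it there by f_j, take
   L_j = L0 - f_j.
   (ii) Conversely, a derivation of A/I inflates to the inner derivation of some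
   L0 whose restriction to I is a trace; if L_j are the approximate trace
   extensions, then L0 - L_j descends to A/I.
   (iii) After subtraction of an inner derivation, D a b vanishes for a, b in I,
   and then it vanishes as soon as a or b is in I, because functionals that
   vanish on products of elements of a weakly amenable algebra are zero.
   (iv) A derivation D of I extends to A by
   D a b = lim_k lim_j D (a e_j) (b e_k), the limits being along an ultrafilter;
   quasi-centrality of e makes this a derivation. *)
Require Import Defs.
From HB Require Import structures.
From mathcomp Require Import all_boot all_order all_algebra complex.
From mathcomp Require Import all_classical all_reals all_analysis.
From mathcomp Require Import ring lra.
Set Implicit Arguments.
Unset Strict Implicit.
Unset Printing Implicit Defensive.
Import Order.TTheory GRing.Theory Num.Theory numFieldNormedType.Exports.
Local Open Scope classical_set_scope.
Local Open Scope complex_scope.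
Local Open Scope ring_scope.

(** * Limits of bounded families along an ultrafilter *)

Section GeneralizedLimit.
Variables (R : realType) (J : Type).
Implicit Types (F : set_system J) (f g : J -> R[i]).

(** Compactness of [-M, M] gives the image filter a cluster point. An ultrafilter contains either
    the preimage of a ball around that point or its complement, and the complement would contradict
    clustering. *)
Lemma ultra_bounded_cvg (U : set_system J) (f : J -> R) (M : R) :
  UltraFilter U -> (forall j, `|f j| <= M) -> cvg (f @ U).
Proof.
move=> UU fM; have PU : ProperFilter U by apply: ultra_proper.
have [|a [_ fa]] := @segment_compact R (- M) M (f @ U) _.
  by apply: (@filterE _ U) => j; rewrite /= in_itv /= -ler_norml; exact: fM.
apply/cvg_ex; exists a; apply/cvgrPdist_lt => e e0.
have [Ue|Une] := in_ultra_setVsetC [set j | `|a - f j| < e] UU; first exact: Ue.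
have [|x [/= xe]] := fa [set x | ~ `|a - x| < e] (ball a e) Une.
  exact: nbhsx_ballx.
by rewrite -ball_normE.
Qed.

Lemma ultra_bounded_complex_cvg (U : set_system J) f (M : R[i]) :
  UltraFilter U -> (forall j, `|f j| <= M) ->
  exists z : R[i]^o, (f : J -> R[i]^o) @ U --> z.
Proof.
move=> UU fM; have PU : ProperFilter U by apply: ultra_proper.
have part (p : R[i] -> R) :
    (forall z, `|p z|%:C <= `|z|) -> exists a : R, p \o f @ U --> a.
  move=> ple; apply/cvg_ex.
  apply: (@ultra_bounded_cvg _ _ (complex.Re M)) => // j.
  by have := le_trans (ple _) (fM j) => /ler_Re.
have [a fa] := part _ (@ler_Re_norm R).
have [b fb] := part _ (@ler_Im_norm R).
exists (a +i* b); apply/cvgrPdist_lt => e e0.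
have eE := ge0_ReE (ltW e0).
have e20 : 0 < complex.Re e / 2 by rewrite divr_gt0// -ltcR -eE.
near=> t.
rewrite eE (le_lt_trans (ler_norm_ReIm _))// ltcR [ltRHS]splitr.
have -> : complex.Re (a +i* b - f t) = a - complex.Re (f t) by case: (f t).
have -> : complex.Im (a +i* b - f t) = b - complex.Im (f t) by case: (f t).
apply: ltrD.
  by near: t; move/cvgrPdist_lt: fa => /(_ _ e20).
by near: t; move/cvgrPdist_lt: fb => /(_ _ e20).
Unshelve. all: by end_near. Qed.

(* The limit along an ultrafilter finer than F. *)
Lemma generalized_limit F : ProperFilter F -> exists Lim : (J -> R[i]) -> R[i],
  [/\ forall k f g (M N : R[i]), (forall j, `|f j| <= M) ->
        (forall j, `|g j| <= N) ->
        Lim (fun j => k * f j + g j) = k * Lim f + Lim g,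
      forall f M, (forall j, `|f j| <= M) -> `|Lim f| <= M &
      forall f (z : R[i]^o), (f : J -> R[i]^o) @ F --> z -> Lim f = z].
Proof.
move=> PF; have [U [UU FU]] := ultraFilterLemma PF.
have PU : ProperFilter U by apply: ultra_proper.
have limE f (z : R[i]^o) : (f : J -> R[i]^o) @ U --> z ->
    lim ((f : J -> R[i]^o) @ U) = z.
  by apply: cvg_lim; exact: norm_hausdorff.
exists (fun f => lim ((f : J -> R[i]^o) @ U)); split.
- move=> k f g M N /(ultra_bounded_complex_cvg UU) [y fy].
  move=> /(ultra_bounded_complex_cvg UU) [z gz].
  rewrite (limE _ _ fy) (limE _ _ gz); apply: limE.
  exact: cvgD (cvgZr (k := k) fy) gz.
- move=> f M fM; have [y fy] := ultra_bounded_complex_cvg UU fM.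
  rewrite (limE _ _ fy); apply/ler_addgt0Pl => e e0.
  have /cvgrPdist_lt/(_ _ e0) Uf := fy; near U => j.
  rewrite -(subrK (f j) y) (le_trans (ler_normD _ _))// lerD//.
  by apply: ltW; near: j.
- by move=> f z fz; apply: limE => S /fz /FU.
Unshelve. all: by end_near. Qed.

End GeneralizedLimit.

(** * The real Hahn-Banach theorem for a sublinear functional *)

Section HahnBanach.
Variables (R : realType) (V : lmodType R) (p : V -> R).
Hypothesis pD : forall u v, p (u + v) <= p u + p v.
Hypothesis pZ : forall t u, 0 < t -> p (t *: u) = t * p u.

(* A linear relation below p is the graph of a partial linear form: if (0, r)
   is in G then so is (0, - r), whence r = 0. *)
Definition dominated_graph (G : set (V * R)) :=
  [/\ G (0, 0),
      forall k u v r s, G (u, r) -> G (v, s) -> G (k *: u + v, k * r + s) &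
      forall u r, G (u, r) -> r <= p u].

Lemma dominated_graph_scale G k u r :
  dominated_graph G -> G (u, r) -> G (k *: u, k * r).
Proof.
by move=> [G0 GP _] Gu; have := GP k _ _ _ _ Gu G0; rewrite !addr0.
Qed.

Lemma dominated_graph_uniq G u r s :
  dominated_graph G -> G (u, r) -> G (u, s) -> r = s.
Proof.
move=> GG; have [_ GP Gp] := GG.
have p0 : p 0 = 0.
  have := @pZ 2 0; rewrite ltr0n scaler0 => /(_ isT); lra.
have le r' s' : G (u, r') -> G (u, s') -> s' <= r'.
  move=> Gr Gs; have := GP (- 1) _ _ _ _ Gr Gs.
  by rewrite scaleN1r addNr => /Gp; rewrite p0; lra.
by move=> Gr Gs; apply/eqP; rewrite eq_le !le.
Qed.

(** A value a at x is admissible iff r - p (u - x) <= a <= p (v + x) - s for all (u, r) and (v, s)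
    in G. By subadditivity every lower constraint is at most every upper one, so the supremum of the
    lower ones serves. *)
Lemma dominated_graph_step G x : dominated_graph G ->
  exists a, dominated_graph
    [set w | exists t u r, G (u, r) /\ w = (u + t *: x, r + t * a)].
Proof.
move=> GG; have [G0 GP Gp] := GG.
pose S := [set w.2 - p (w.1 - x) | w in G].
have Sub v s : G (v, s) -> ubound S (p (v + x) - s).
  move=> Gv _ [[u r] /= Gu <-]; have := GP 1 _ _ _ _ Gu Gv.
  rewrite scale1r mul1r => /Gp.
  have -> : u + v = (u - x) + (v + x) by rewrite addrACA addNr addr0.
  by move=> /le_trans /(_ (pD _ _)); lra.
have hS : has_sup S.
  split; first by exists (0 - p (0 - x)), (0, 0).
  by exists (p (0 + x) - 0); exact: Sub.
exists (sup S); split.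
- by exists 0, 0, 0; rewrite scale0r mul0r !addr0.
- move=> k _ _ _ _ [t [u [r [Gu [-> ->]]]]] [t' [v [s [Gv [-> ->]]]]].
  exists (k * t + t'), (k *: u + v), (k * r + s); split; first exact: GP.
  by congr (_, _); [rewrite scalerDr scalerDl scalerA addrACA|ring].
- move=> _ _ [t [u [r [Gu [-> ->]]]]].
  (* Dividing by [- t] or by [t] reduces the bound at [u + t *: x] to a lower or an upper constraint
     on the value at x. *)
  have [t0|t0|->] := ltgtP t 0; last by rewrite mul0r scale0r !addr0 Gp.
    pose s := - t; have s0 : 0 < s by rewrite oppr_gt0.
    have /(sup_upper_bound hS) : S (s^-1 * r - p (s^-1 *: u - x)).
      by exists (s^-1 *: u, s^-1 * r) => //; exact: dominated_graph_scale.
    rewrite -(ler_pM2l s0) mulrBr -pZ// scalerBr !scalerA mulrA divff ?gt_eqF//.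
    rewrite mul1r scale1r -scaleNr opprK /s mulNr; lra.
  have := sup_le_ub hS.1 (Sub _ _ (dominated_graph_scale t^-1 GG Gu)).
  rewrite -(ler_pM2l t0) mulrBr -pZ// scalerDr !scalerA mulrA divff ?gt_eqF//.
  rewrite mul1r scale1r; lra.
Qed.

Theorem hahn_banach G : dominated_graph G ->
  exists F : V -> R, [/\ scalar F, forall u, F u <= p u &
    forall u r, G (u, r) -> F u = r].
Proof.
move=> GG.
(* The union with G, in place of the condition that H contain G, makes the empty union of the empty
   chain admissible. *)
have [|M [MM Mmax]] := @Zorn_bigcup _ [set H | dominated_graph (H `|` G)].
  move=> C CP Ctot; have [[H0 CH0]|C0] := pselect (C !=set0); last first.
    rewrite /= (_ : \bigcup_(X in C) X = set0) ?set0U//.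
    by rewrite -subset0 => w [X CX _]; apply: C0; exists X.
  have pair w w' : (\bigcup_(X in C) X `|` G) w ->
      (\bigcup_(X in C) X `|` G) w' ->
      exists2 X, C X & (X `|` G) w /\ (X `|` G) w'.
    move=> [[X CX Xw]|Gw] [[Y CY Yw]|Gw'];
      last by exists H0 => //; split; right.
    - have [XY|YX] := Ctot _ _ CX CY.
        by exists Y => //; split; left => //; exact: XY.
      by exists X => //; split; left => //; exact: YX.
    - by exists X => //; split; [left|right].
    - by exists Y => //; split; [right|left].
  split; first by right; case: GG.
  - move=> k u v r s uC vC; have [X CX [Xu Xv]] := pair _ _ uC vC.
    have [_ XP _] := CP _ CX; have [?|?] := XP k _ _ _ _ Xu Xv; last by right.
    by left; exists X.
  - move=> u r uC; have [X CX [Xu _]] := pair _ _ uC uC.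
    by have [_ _] := CP _ CX; apply.
set H := M `|` G in MM.
(* [M] with G adjoined is admissible as well, so by maximality G already lies in [M]. *)
have HM : H `<=` M.
  apply: contrapT => HM; apply: (Mmax H) => [|/=].
    by rewrite properEneq; split; [apply/eqP => E; apply: HM; rewrite -E|left].
  by rewrite /H -setUA setUid.
have HH : dominated_graph H := MM.
have Htot x : exists r, H (x, r).
  have [a Ha] := dominated_graph_step x HH.
  set H' := [set w | _] in Ha.
  have HH' : H `<=` H'.
    by move=> [u r] Hu; exists 0, u, r; rewrite scale0r mul0r !addr0.
  exists a; apply: contrapT => nH; apply: (Mmax H') => [|/=].
    split; first by move=> w Mw; apply/HH'; left.
    move=> H'M; apply: nH; left; apply: H'M.
    by exists 1, 0, 0; rewrite scale1r mul1r !add0r; split=> //; case: HH.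
  by rewrite setUC setUidr// => w Gw; apply: HH'; right.
have [F FH] := choice Htot.
have [_ HP Hp] := HH.
exists F; split.
- move=> k u v; apply: (dominated_graph_uniq HH (FH _)).
  by apply: HP; exact: FH.
- by move=> u; apply: Hp; exact: FH.
- by move=> u r Gu; apply: (dominated_graph_uniq HH (FH _)); right.
Qed.

End HahnBanach.

(** * Extension of functionals on complex normed spaces *)

Section DualExtension.
Variable R : realType.

(** A separate name for V, so that its real scalar action does not compete with the complex one. *)
Definition realified (V : lmodType R[i]) : Type := V.
HB.instance Definition _ (V : lmodType R[i]) := GRing.Zmodule.on (realified V).

Section Realified.
Variable V : lmodType R[i].

Definition real_scale (k : R) (v : realified V) : realified V :=
  k%:C *: (v : V).

Fact real_scaleA k l v : real_scale k (real_scale l v) = real_scale (k * l) v.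
Proof. by rewrite /real_scale scalerA -real_complexM. Qed.
Fact real_scale1 : left_id 1 real_scale.
Proof. by move=> v; rewrite /real_scale scale1r. Qed.
Fact real_scaleDr : right_distributive real_scale +%R.
Proof. by move=> k u v; exact: scalerDr. Qed.
Fact real_scaleDl v : {morph real_scale^~ v : k l / k + l}.
Proof. by move=> k l; rewrite /real_scale real_complexD scalerDl. Qed.
HB.instance Definition _ := GRing.Zmodule_isLmodule.Build R (realified V)
  real_scaleA real_scale1 real_scaleDr real_scaleDl.

End Realified.

(* A complex-linear form F is recovered from its real part U by
   F v = U v - i U (i v), so it suffices to extend Re f by Hahn-Banach. *)
Lemma dual_extension (V W : normedModType R[i]) (T : {linear W -> V})
    (f : dual W) :
  (forall w, `|w| <= `|T w|) -> exists F : dual V, forall w, F (T w) = f w.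
Proof.
move=> hT; have [M M0 fM] := dual_boundedP f.
pose p (v : realified V) := M * complex.Re `|v : V|.
have pD u v : p (u + v) <= p u + p v.
  by rewrite -mulrDr ler_wpM2l// Re_normD.
have pZ t u : 0 < t -> p (t *: u) = t * p u.
  move=> t0; rewrite /p mulrCA; congr (_ * _).
  rewrite [_ *: u]/(t%:C *: (u : V)) normrZ gtr0_norm ?ltcR//.
  by rewrite [`|u : V|]ge0_ReE//= mul0r subr0.
have ReD (y z : R[i]) : complex.Re (y + z) = complex.Re y + complex.Re z.
  by case: y z => [? ?] [].
have ReZ (k : R) (z : R[i]) : complex.Re (k%:C * z) = k * complex.Re z.
  by case: z => a b /=; rewrite mul0r subr0.
(* The graph sends T w to Re (f w). It lies below p since |f w| <= M |w| <= M |T w|, and this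
   domination also makes it single-valued. *)
have [|U [Ulin Up UG]] := hahn_banach pD pZ
    (G := [set z | exists w, z = (T w, complex.Re (f w))]).
  split; first by exists 0; rewrite !linear0.
  - move=> k _ _ _ _ [w [-> ->]] [w' [-> ->]]; exists (k%:C *: w + w').
    rewrite !linearP ReD; congr (_, _ + _).
    exact: esym (ReZ k (f w)).
  - move=> _ _ [w [-> ->]].
    rewrite (le_trans (ler_norm _))// -lecR (le_trans (ler_Re_norm _))//.
    rewrite (le_trans (fM w))// real_complexM -ge0_ReE// ler_wpM2l ?ler0c//.
have UD u v : U (u + v) = U u + U v.
  by have := Ulin 1 u v; rewrite scale1r mul1r.
have U0 : U 0 = 0 by apply: (addrI (U 0)); rewrite -UD !addr0.
have UZ k u : U (k%:C *: (u : V)) = k * U u.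
  by have := Ulin k u 0; rewrite U0 !addr0.
have Uabs v : `|U v| <= p v.
  rewrite ler_norml Up andbT lerNl -[- U v]mulN1r -UZ (le_trans (Up _))//.
  by rewrite /p normrZ rmorphN normrN normr1 mul1r.
pose F (v : V) : R[i] := U v +i* - U ('i%C *: v).
have Flin : scalar F.
  move=> [a b] u v.
  have eC : (a +i* b) = a%:C + b%:C * 'i%C :> R[i].
    by apply/eqP; rewrite eq_complex /=; apply/andP; split; apply/eqP; ring.
  have eI : 'i%C * (a +i* b) = a%:C * 'i%C + (- b)%:C :> R[i].
    by apply/eqP; rewrite eq_complex /=; apply/andP; split; apply/eqP; ring.
  rewrite /F scalerDr scalerA eI eC !scalerDl -!scalerA.
  rewrite !UD !UZ -eC; apply/eqP; rewrite eq_complex /=.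
  by apply/andP; split; apply/eqP; ring.
have Fbnd : exists N : R[i], forall v, `|F v| <= N * `|v|.
  exists (M + M)%:C => v; rewrite (le_trans (ler_norm_ReIm _))// /F /=.
  rewrite normrN [`|v|]ge0_ReE// -real_complexM lecR mulrDl lerD//.
  rewrite (le_trans (Uabs _))// /p normrZ.
  rewrite (_ : `|'i%C| = 1) ?mul1r//.
  by rewrite normc_def /= expr0n /= add0r expr1n sqrtr1.
have UT w : U (T w) = complex.Re (f w) by apply: UG; exists w.
exists (Dual Flin Fbnd) => w /=; rewrite /F -linearZ !UT linearZ.
suff fE (z : R[i]) : complex.Re z +i* - complex.Re ('i%C * z) = z by exact: fE.
by case: z => a b; apply/eqP; rewrite eq_complex /=; apply/andP; split;
  apply/eqP; ring.
Qed.

End DualExtension.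

Lemma dualP (R : realType) (V : normedModType R[i]) (f : dual V) k u v :
  f (k *: u + v) = k * f u + f v.
Proof. exact: dual_linear. Qed.

Lemma dual_argB (R : realType) (V : normedModType R[i]) (f : dual V) u v :
  f (u - v) = f u - f v.
Proof. exact: linearB. Qed.

(** * Adjoints of contractions *)

Section DualComposition.
Variables (R : realType) (V W : normedModType R[i]) (T : {linear V -> W}).
Hypothesis T1 : forall v, `|T v| <= `|v|.

(** The two instances below are restriction to I and inflation along A -> A/I. *)
Program Definition dual_comp (f : dual W) : dual V :=
  @Dual R V (fun v => f (T v)) _ _.
Next Obligation. by move=> f k u v; rewrite !linearP. Qed.
Next Obligation.
move=> f; exists `|f| => v; rewrite (le_trans (ler_dual_norm _ _))//.
by rewrite ler_wpM2l.
Qed.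

Lemma ler_norm_dual_comp f : `|dual_comp f| <= `|f|.
Proof.
apply: dual_norm_le => // v; rewrite (le_trans (ler_dual_norm f (T v)))//.
by rewrite ler_wpM2l.
Qed.

End DualComposition.

(** Serves to carry the convergence of a net of inner derivations from one dual space to another. *)
Lemma cvg_norm_sub_le (K : numFieldType) (V W : normedModType K) (T : Type)
    (F : set_system T) (f : T -> V) (g : T -> W) l m : Filter F ->
  (forall t, `|m - g t| <= `|l - f t|) -> f @ F --> l -> g @ F --> m.
Proof.
move=> FF gf /cvgrPdist_lt fl; apply/cvgrPdist_lt => e /fl.
by apply: filterS => t; apply: le_lt_trans.
Qed.

(** * Bounded derivations into the dual *)

Section Cocycles.
Variable R : realType.
Implicit Types A : banachAlgType R[i].

(* A bounded derivation into the dual, with the actions on the dual unfolded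
   and without a bundled linear map. *)
Definition cocycle A (D : A -> dual A) :=
  [/\ linear D, bounded_operator D &
    forall a b c, D (a ** b) c = D b (c ** a) + D a (b ** c)].

(** The inner derivation of f, written with the module actions so as to be convertible with the
    expression in [inner]. *)
Definition coad A (f : dual A) (a : A) : dual A :=
  @lact _ _ (dual_bimodule (regular_bimodule A)) a f -
  @ract _ _ (dual_bimodule (regular_bimodule A)) f a.

Lemma coadE A (f : dual A) a b : coad f a b = f (b ** a) - f (a ** b).
Proof. exact: dualBE. Qed.

Lemma coadD A (f g : dual A) a :
  coad (f + g) a = coad f a + coad g a.
Proof.
by apply: dual_ext => b; rewrite [RHS]dualDE !coadE !dualDE; ring.
Qed.

Lemma coadB A (f g : dual A) a :
  coad (f - g) a = coad f a - coad g a.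
Proof. by apply: dual_ext => b; rewrite dualBE !coadE !dualBE; ring. Qed.

Lemma cocycle_coad A (f : dual A) : cocycle (coad f).
Proof.
split.
- move=> k a b; apply: dual_ext => c; rewrite [LHS]coadE dualDE dualZE !coadE.
  by rewrite amulDr amulDl amulZr amulZl !dualP; ring.
- exists (`|f| + `|f|) => a; apply: dual_norm_le => [|c].
    by rewrite mulr_ge0 ?addr_ge0.
  rewrite coadE !mulrDl -!mulrA (le_trans (ler_normB _ _))// lerD//.
    by rewrite (le_trans (ler_dual_norm _ _))// ler_wpM2l// mulrC ler_norm_amul.
  by rewrite (le_trans (ler_dual_norm _ _))// ler_wpM2l// ler_norm_amul.
- by move=> a b c; rewrite !coadE !amulA; ring.
Qed.

Lemma cocycleB A (D E : A -> dual A) :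
  cocycle D -> cocycle E -> cocycle (fun a => D a - E a).
Proof.
move=> [Dl [M DM] Dd] [El [N EN] Ed]; split.
- by move=> k a b; rewrite Dl El scalerBr addrACA -opprD.
- by exists (M + N) => a; rewrite mulrDl (le_trans (ler_normB _ _))// lerD.
- by move=> a b c; rewrite !dualBE Dd Ed; ring.
Qed.

Lemma derivation_cocycle A
    (D : {linear A -> dual_bimodule (regular_bimodule A)}) :
  bounded_operator D -> derivation D -> cocycle (D : A -> dual A).
Proof.
move=> Db Dd; split=> //; first by move=> k a b; exact: linearP.
by move=> a b c; rewrite Dd.
Qed.

Lemma cocycle_derivation A (D : A -> dual A) : cocycle D ->
  exists D' : {linear A -> dual_bimodule (regular_bimodule A)},
    [/\ D' =1 D, bounded_operator D' & derivation D'].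
Proof.
move=> [Dl Db Dd].
pose D' : {linear A -> dual_bimodule (regular_bimodule A)} :=
  HB.pack (D : A -> dual_bimodule (regular_bimodule A))
   (GRing.isLinear.Build R[i] A (dual_bimodule (regular_bimodule A)) *:%R D Dl).
exists D'; split=> // a b; apply: dual_ext => c; exact: Dd.
Qed.

Lemma weakly_amenable_cocycle A (D : A -> dual A) :
  weakly_amenable A -> cocycle D -> exists f, forall a, D a = coad f a.
Proof.
move=> wA /cocycle_derivation[D' [D'E /wA D'b /D'b[f fD]]].
by exists f => a; rewrite -D'E; exact: fD.
Qed.

Lemma approximately_weakly_amenable_cocycle A :
  approximately_weakly_amenable A <->
  forall D : A -> dual A, cocycle D ->
    exists (J : directed_set) (f : J -> dual A),
      forall a, coad (f j) a @[j --> tails J] --> D a.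
Proof.
split=> [wA D /cocycle_derivation[D' [D'E /wA D'b /D'b[J [f fD]]]]|wA D Db Dd].
  by exists J, f => a; rewrite -D'E; exact: fD.
exact: wA (derivation_cocycle Db Dd).
Qed.

End Cocycles.

(** Currying of a bounded bilinear form; it turns derivations given by a two-variable formula into
    maps into the dual. *)
Lemma bilinear_dual (R : realType) (V W : normedModType R[i])
    (B : V -> W -> R[i]) (C : R[i]) :
  (forall w, scalar (B^~ w)) -> (forall v, scalar (B v)) ->
  (forall v w, `|B v w| <= C * `|v| * `|w|) ->
  exists G : V -> dual W,
    [/\ linear G, bounded_operator G & forall v w, G v w = B v w].
Proof.
move=> Bl Br BC.
have Bb v : exists M : R[i], forall w, `|B v w| <= M * `|w|.
  by exists (C * `|v|) => w; exact: BC.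
exists (fun v => Dual (Br v) (Bb v)); split=> //.
- by move=> k u v; apply: dual_ext => w; exact: Bl.
- exists `|C| => v; apply: dual_norm_le => [|w]; first by rewrite mulr_ge0.
  by rewrite -mulrA ler_normM ?mulr_ge0// mulrA; exact: BC.
Qed.

Lemma cocycle_bound (R : realType) (A : banachAlgType R[i]) (D : A -> dual A) :
  cocycle D -> exists2 C : R[i], 0 <= C &
    forall a b, `|D a b| <= C * `|a| * `|b|.
Proof.
move=> [_ [C DC] _]; exists `|C| => // a b.
rewrite (le_trans (ler_dual_norm _ _))// ler_wpM2r// ler_normM//.
Qed.

Lemma cocycle_scalar (R : realType) (A : banachAlgType R[i]) (D : A -> dual A)
  b : cocycle D -> scalar (fun a => D a b).
Proof. by move=> [Dl _ _] k u v; rewrite Dl. Qed.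

(** With the second variable frozen, statements about functionals become available for the first
    variable. *)
Lemma cocycle_transpose (R : realType) (A : banachAlgType R[i])
    (D : A -> dual A) b :
  cocycle D -> exists g : dual A, forall a, g a = D a b.
Proof.
move=> Dc; have [C C0 DC] := cocycle_bound Dc.
have gb : exists M : R[i], forall a, `|D a b| <= M * `|a|.
  by exists (C * `|b|) => a; rewrite mulrAC.
by exists (Dual (cocycle_scalar b Dc) gb).
Qed.

(** * Restriction from A to the ideal *)

Section Restriction.
Variables (R : realType) (A : banachAlgType R[i]) (I : closed_ideal A).

Lemma ideal_norm_val (x : ideal_alg I) : `|\val x| <= `|x|.
Proof. exact: lexx. Qed.

Definition restrict : dual A -> dual (ideal_alg I) := dual_comp ideal_norm_val.

Lemma restrictE f x : restrict f x = f (ideal_val x).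
Proof. by []. Qed.

Lemma restrictB f g : restrict (f - g) = restrict f - restrict g.
Proof. by apply: dual_ext => x; rewrite !(restrictE, dualBE). Qed.

Lemma restrict_coad f x :
  coad (restrict f) x = restrict (coad f (ideal_val x)).
Proof. by apply: dual_ext => y; rewrite restrictE !coadE. Qed.

Lemma cocycle_restrict (D : A -> dual A) :
  cocycle D -> cocycle (fun x : ideal_alg I => restrict (D (ideal_val x))).
Proof.
move=> [Dl [M DM] Dd]; split.
- move=> k x y; apply: dual_ext => z.
  by rewrite dualDE dualZE !restrictE -[ideal_val (_ + _)]/(\val _) linearP Dl.
- by exists M => x; rewrite (le_trans (ler_norm_dual_comp _ _))//; exact: DM.
- by move=> x y z; rewrite !restrictE Dd.
Qed.

(** Hahn-Banach for the isometric inclusion of I in A. *)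
Lemma restrict_surj (f : dual (ideal_alg I)) : exists F, restrict F = f.
Proof.
have [F FE] := dual_extension f (fun x => lexx `|\val x|).
by exists F; apply: dual_ext => x; rewrite restrictE FE.
Qed.

Lemma ideal_set_val (x : ideal_alg I) : ideal_set I (ideal_val x).
Proof. by apply/ideal_predP; exact: ideal_valP. Qed.

Lemma ideal_eltP x : ideal_set I x -> exists y : ideal_alg I, ideal_val y = x.
Proof. by move=> /ideal_predP Ix; exists (IdealElt Ix). Qed.

End Restriction.

(** * Inflation from A/I to A *)

Section Inflation.
Variables (R : realType) (A : banachAlgType R[i]) (I : closed_ideal A).
Local Notation q := (@quotient_proj R A I).

Lemma quotient_projM a b : q (a ** b) = q a ** q b.
Proof. by rewrite -quotient_mulE. Qed.

Lemma quotient_proj_ideal a : ideal_set I a -> q a = 0.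
Proof.
by move=> Ia; rewrite -(raddf0 q); apply/quotient_projE; rewrite subr0.
Qed.

(** The quotient norm is an infimum over lifts, so a bound that holds for every lift holds for the
    class. *)
Lemma quotient_bound (W : normedModType R[i]) (f : quotient_alg I -> W)
    (M : R[i]) : 0 <= M ->
  (forall a, `|f (q a)| <= M * `|a|) -> forall x, `|f x| <= M * `|x|.
Proof.
move=> M0 fM x; apply/ler_addgt0Pr => e e0.
have M1 : 0 < M + 1 by rewrite ltr_wpDl.
(* This slack, multiplied by M, stays below e, and M = 0 is allowed. *)
have d0 : 0 < e / (M + 1) by rewrite divr_gt0.
have [|a <- ae] := @quotient_norm_lift R A I x (complex.Re (e / (M + 1))).
  by rewrite -ltcR -ge0_ReE ?ltW.
have {}ae : `|a| <= `|q a| + e / (M + 1).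
  by rewrite quotient_normE [leLHS]ge0_ReE// (ge0_ReE (ltW d0)) -real_complexD
    lecR ltW.
rewrite (le_trans (fM a))// (le_trans (ler_wpM2l M0 ae))// mulrDr lerD2l.
by rewrite mulrCA ger_pMr// ler_pdivrMr// mul1r lerDl.
Qed.

Definition inflate : dual (quotient_alg I) -> dual A :=
  dual_comp (@ler_quotient_proj R A I).

Lemma inflateE f a : inflate f a = f (q a).
Proof. by []. Qed.

Lemma inflateB f g : inflate (f - g) = inflate f - inflate g.
Proof. by apply: dual_ext => x; rewrite !(inflateE, dualBE). Qed.

Lemma inflate_coad f a : coad (inflate f) a = inflate (coad f (q a)).
Proof.
by apply: dual_ext => b; rewrite inflateE !coadE !inflateE !quotient_projM.
Qed.

(** Equality, and not just contractivity, is what lets a limit in the dual of A be read in the dual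
    of A/I. *)
Lemma norm_inflate f : `|inflate f| = `|f|.
Proof.
apply/eqP; rewrite eq_le ler_norm_dual_comp/=.
apply: dual_norm_le => // x; apply: (@quotient_bound R[i]^o f) => // a.
exact: (ler_dual_norm (inflate f) a).
Qed.

Lemma inflate_cocycle (D : quotient_alg I -> dual (quotient_alg I)) :
  cocycle D -> cocycle (fun a => inflate (D (q a))).
Proof.
move=> [Dl [M DM] Dd]; split.
- move=> k a b; apply: dual_ext => c.
  by rewrite dualDE dualZE !inflateE linearP Dl.
- exists `|M| => a; rewrite norm_inflate.
  apply: le_trans (ler_normM _ _ (DM (q a))) _ => //.
  by rewrite ler_wpM2l// ler_quotient_proj.
- by move=> a b c; rewrite !inflateE !quotient_projM Dd.
Qed.

(** The dual of A/I is the annihilator of I: f composed with any section of the projection does not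
    depend on the section. *)
Lemma inflate_surj (f : dual A) :
  (forall x, ideal_set I x -> f x = 0) -> exists g, inflate g = f.
Proof.
move=> fI; have /choice[s qs] := @quotient_surj R A I.
have fs a : f (s (q a)) = f a.
  apply/eqP; rewrite -subr_eq0 -dual_argB fI//.
  by apply/quotient_projE; rewrite qs.
have gl : scalar (f \o s).
  move=> k x y; have [a <-] := quotient_surj x; have [b <-] := quotient_surj y.
  by rewrite -quotient_projZ -quotient_projD /= !fs dualP.
have gb : exists M : R[i], forall x, `|(f \o s) x| <= M * `|x|.
  exists `|f|; apply: (@quotient_bound R[i]^o) => // a /=.
  by rewrite fs; exact: ler_dual_norm.
by exists (Dual gl gb); apply: dual_ext => a; rewrite inflateE /= fs.
Qed.

(** Vanishing in the second variable makes each D a a functional on A/I; vanishing in the first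
    makes it depend only on the class of a. *)
Lemma cocycle_inflate_surj (D : A -> dual A) : cocycle D ->
  (forall a x, ideal_set I x -> D a x = 0) ->
  (forall x a, ideal_set I x -> D x a = 0) ->
  exists2 E, cocycle E & forall a, inflate (E (q a)) = D a.
Proof.
move=> Dc DI ID; have [C C0 DC] := cocycle_bound Dc.
have [Dl _ Dd] := Dc.
have /choice[s qs] := @quotient_surj R A I.
have /choice[g gE] a := inflate_surj (DI a).
have gs a : g (s (q a)) = g a.
  apply: dual_ext => x; have [b <-] := quotient_surj x.
  rewrite -!inflateE !gE; have [h hE] := cocycle_transpose b Dc.
  apply/eqP; rewrite -!hE -subr_eq0 -dual_argB hE ID//.
  by apply/quotient_projE; rewrite qs.
exists (g \o s) => [|a /=]; last by rewrite gs gE.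
split.
- move=> k x y; have [a <-] := quotient_surj x; have [b <-] := quotient_surj y.
  rewrite -quotient_projZ -quotient_projD /= !gs.
  apply: dual_ext => z; have [c <-] := quotient_surj z.
  by rewrite dualDE dualZE -!inflateE !gE Dl.
- exists C; apply: quotient_bound => // a /=.
  rewrite gs -norm_inflate gE; apply: dual_norm_le => //.
  by rewrite mulr_ge0.
- move=> x y z; have [a <-] := quotient_surj x.
  have [b <-] := quotient_surj y; have [c <-] := quotient_surj z.
  by rewrite -!quotient_projM /= !gs -!inflateE !gE Dd.
Qed.

(** The common core of (i) and (iii): descend to A/I, approximate there, inflate the
    approximants. *)
Lemma quotient_approximately_inner (D : A -> dual A) :
  approximately_weakly_amenable (quotient_alg I) -> cocycle D ->
  (forall a x, ideal_set I x -> D a x = 0) ->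
  (forall x a, ideal_set I x -> D x a = 0) ->
  exists (J : directed_set) (f : J -> dual A),
    (forall j x, ideal_set I x -> f j x = 0) /\
    (forall a, coad (f j) a @[j --> tails J] --> D a).
Proof.
move=> /approximately_weakly_amenable_cocycle wA Dc DI ID.
have [E /wA[J [f fE]] ED] := cocycle_inflate_surj Dc DI ID.
exists J, (fun j => inflate (f j)); split=> [j x Ix|a].
  by rewrite inflateE quotient_proj_ideal// linear0.
apply: cvg_norm_sub_le (fE (q a)) => j.
by rewrite inflate_coad -ED -inflateB norm_inflate.
Qed.

End Inflation.

(* For such an f, the map x |-> f(x) f is a derivation; if it equals
   x |-> x . g - g . x then f(x)^2 = g(x^2) - g(x^2) = 0. *)
Lemma weakly_amenable_dual0 (R : realType) (A : banachAlgType R[i])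
    (f : dual A) :
  weakly_amenable A -> (forall a b, f (a ** b) = 0) -> f = 0.
Proof.
move=> wA f0.
have [|g gE] := @weakly_amenable_cocycle _ _ (fun a => f a *: f) wA.
  split.
  - by move=> k a b; rewrite dualP scalerDl scalerA.
  - exists (`|f| * `|f|) => a; rewrite normrZ mulrAC ler_wpM2r//.
    exact: ler_dual_norm.
  - by move=> a b c; rewrite !dualZE !f0 mul0r !mulr0 addr0.
apply: dual_ext => a; have := congr1 (fun h : dual A => h a) (gE a).
by rewrite dualZE coadE subrr => /eqP; rewrite mulf_eq0 orbb => /eqP.
Qed.

(** * Parts (i) to (iii): ideals, quotients and extensions *)

Section HereditaryProperties.
Variables (R : realType) (A : banachAlgType R[i]) (I : closed_ideal A).

Lemma quotient_approximate_trace_extension :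
  approximately_weakly_amenable (quotient_alg I) ->
  approximate_trace_extension I.
Proof.
move=> wQ lambda tr; have [L0 L0E] := restrict_surj lambda.
(* Both products lie in I, where L0 is lambda. Hence [coad L0] vanishes as soon as one of its
   variables is in I. *)
have tr0 a (x : ideal_alg I) :
    L0 (ideal_val x ** a) = L0 (a ** ideal_val x).
  have := congr1 (fun h : dual (ideal_alg I) => h x) (tr a).
  by rewrite /= -L0E.
have [||J [f [fI fE]]] :=
    quotient_approximately_inner wQ (cocycle_coad L0).
- by move=> a _ /ideal_eltP[x <-]; rewrite coadE tr0 subrr.
- by move=> _ a /ideal_eltP[x <-]; rewrite coadE tr0 subrr.
exists J, (fun j => L0 - f j); split=> [j x|a].
  by rewrite dualBE (fI _ _ (ideal_set_val x)) subr0 -L0E.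
apply: cvg_norm_sub_le (fE a) => j.
by rewrite -[_ - _ in leLHS]/(0 - coad _ a) coadB sub0r normrN.
Qed.

Lemma quotient_approximately_weakly_amenable :
  weakly_amenable A -> approximate_trace_extension I ->
  approximately_weakly_amenable (quotient_alg I).
Proof.
move=> wA tI; apply/approximately_weakly_amenable_cocycle => D Dc.
have [L0 L0E] := weakly_amenable_cocycle wA (inflate_cocycle Dc).
(* The restriction is a trace: L0 (x a) - L0 (a x) = D (q a) (q x), and q x = 0 for x in I. *)
have [a|J [L [LI Ltr]]] := tI (restrict I L0 : dual (ideal_bimodule I)).
  apply: dual_ext => x; apply/eqP.
  rewrite -subr_eq0 -[_ - _]/(L0 (\val x ** a) - L0 (a ** \val x)) -coadE -L0E.
  by rewrite inflateE (quotient_proj_ideal (ideal_set_val x)) linear0.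
have /choice[g gE] (j : J) :
    exists g : dual (quotient_alg I), inflate g = L0 - L j.
  apply: (@inflate_surj R A I) => _ /ideal_eltP[x <-].
  by rewrite dualBE LI restrictE subrr.
exists J, g => x; have [a <-] := quotient_surj x.
(* After inflation the error D (q a) - [coad (g j) (q a)] becomes [coad (L j) a]. *)
apply: cvg_norm_sub_le (Ltr a) => j.
rewrite -norm_inflate inflateB -inflate_coad gE coadB L0E subKr.
by rewrite -[_ - _ in leRHS]/(0 - coad _ a) sub0r normrN.
Qed.

Lemma extension_approximately_weakly_amenable :
  weakly_amenable (ideal_alg I) ->
  approximately_weakly_amenable (quotient_alg I) ->
  approximately_weakly_amenable A.
Proof.
move=> wI wQ; apply/approximately_weakly_amenable_cocycle => D Dc.
have [l lE] := weakly_amenable_cocycle wI (cocycle_restrict I Dc).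
have [L LE] := restrict_surj l.
pose E a := D a - coad L a.
have Ec : cocycle E := cocycleB Dc (cocycle_coad L).
have [_ _ Ed] := Ec.
have EII (x y : ideal_alg I) : E (ideal_val x) (ideal_val y) = 0.
  rewrite -restrictE restrictB lE -LE.
  by rewrite -restrict_coad subrr.
(* The functional x |-> E x a on I kills products: E (y z) a = E z (a y) + E y (z a), with all
   arguments in I. *)
have EI (x : ideal_alg I) a : E (ideal_val x) a = 0.
  have [g gE] := cocycle_transpose a Ec.
  have g0 : restrict I g = 0.
    apply: weakly_amenable_dual0 => // y z.
    rewrite restrictE gE -[ideal_val _]/(ideal_val y ** ideal_val z) Ed.
    by rewrite (EII z (ideal_lmul a y)) (EII y (ideal_rmul z a)) addr0.
  by rewrite -gE -restrictE g0.
(* Here E (a y) z = E y (z a) + E a (y z), and the first two terms vanish. *)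
have EA a (x : ideal_alg I) : E a (ideal_val x) = 0.
  suff g0 : restrict I (E a) = 0 by rewrite -restrictE g0.
  apply: weakly_amenable_dual0 => // y z.
  rewrite restrictE -[ideal_val _]/(ideal_val y ** ideal_val z).
  have : E (a ** ideal_val y) (ideal_val z) = 0 := EII (ideal_lmul a y) z.
  by rewrite Ed (EII y (ideal_rmul z a)) add0r.
have [||J [f [_ fE]]] := quotient_approximately_inner wQ Ec.
- by move=> a _ /ideal_eltP[x <-].
- by move=> _ a /ideal_eltP[x <-].
exists J, (fun j => f j + L) => a.
apply: cvg_norm_sub_le (fE a) => j.
by rewrite coadD opprD addrA addrAC.
Qed.

End HereditaryProperties.

Lemma dual_cvg (R : realType) (V : normedModType R[i]) (f : dual V)
    (J : directed_set) (u : J -> V) v :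
  u @ tails J --> v -> (fun j => f (u j) : R[i]^o) @ tails J --> (f v : R[i]^o).
Proof.
move=> /cvgrPdist_lt uv; apply/cvgrPdist_lt => e e0.
have f1 : 0 < `|f| + 1 by rewrite ltr_wpDl.
have := uv _ (divr_gt0 e0 f1); apply: filterS => t; rewrite ltr_pdivlMr// => ut.
rewrite -dual_argB (le_lt_trans (ler_dual_norm _ _))// (le_lt_trans _ ut)//.
by rewrite mulrC ler_wpM2l// lerDl.
Qed.

(** * Part (iv): extending a derivation of I to A *)

Section QuasiCentral.
Variables (R : realType) (A : banachAlgType R[i]) (I : closed_ideal A).
Variables (J : directed_set) (e : J -> ideal_alg I) (M : R[i]).
Hypothesis eM : forall j, `|e j| <= M.
Hypothesis eL : forall x, e j ** x @[j --> tails J] --> x.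
Hypothesis eR : forall x, x ** e j @[j --> tails J] --> x.
Hypothesis qe : quasi_central e.
Local Notation B := (ideal_alg I).

Variable Lim : (J -> R[i]) -> R[i].
Hypothesis LimP : forall k f g (N P : R[i]), (forall j, `|f j| <= N) ->
  (forall j, `|g j| <= P) ->
  Lim (fun j => k * f j + g j) = k * Lim f + Lim g.
Hypothesis LimM : forall f N, (forall j, `|f j| <= N) -> `|Lim f| <= N.
Hypothesis LimE : forall f (z : R[i]^o),
  (f : J -> R[i]^o) @ tails J --> z -> Lim f = z.

(** The bound C, uniform in j, keeps every family within the range where [Lim] is linear, and it
    survives in the limit. Both successive limits of the extension are obtained this way. *)
Lemma Lim_bilinear (V W : normedModType R[i]) (b : J -> V -> W -> R[i]) C :
  (forall j w, scalar ((b j)^~ w)) -> (forall j v, scalar (b j v)) ->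
  (forall j v w, `|b j v w| <= C * `|v| * `|w|) ->
  exists G : V -> dual W,
    [/\ linear G, bounded_operator G &
      forall v w, G v w = Lim (fun j => b j v w)].
Proof.
move=> bl br bC; apply: (@bilinear_dual _ _ _ _ C) => [w k u v|v k u w|v w].
- rewrite -(LimP k (fun j => bC j u w) (fun j => bC j v w)).
  by congr Lim; apply/funext => j; exact: bl.
- rewrite -(LimP k (fun j => bC j v u) (fun j => bC j v w)).
  by congr Lim; apply/funext => j; exact: br.
- by apply: LimM => j; exact: bC.
Qed.

Lemma ideal_lmulP k a b (x : B) :
  ideal_lmul (k *: a + b) x = k *: ideal_lmul a x + ideal_lmul b x.
Proof. by apply: val_inj; rewrite /= amulDl amulZl. Qed.

Lemma norm_ideal_lmul a j : `|ideal_lmul a (e j)| <= `|a| * M.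
Proof.
rewrite (le_trans (ler_norm_amul a (\val (e j))))// ler_wpM2l//; exact: eM.
Qed.

(** Each x in I is the limit of the products e_j x. *)
Lemma dual_ideal_eq (f g : dual B) :
  (forall x y, f (x ** y) = g (x ** y)) -> f = g.
Proof.
move=> fg; apply: dual_ext => x.
have fx := dual_cvg (f := f) (@eL x); have gx := dual_cvg (f := g) (@eL x).
rewrite -(LimE fx) -(LimE gx).
by congr Lim; apply/funext => j; exact: fg.
Qed.

Section Extension.
Variable D : B -> dual B.
Hypothesis Dc : cocycle D.

(** The inner limit, E a x = lim_j D (a e_j) x, extends D to a derivation from A into the dual of I.
    The derivation identity is checked on products x y, where E has a formula free of limits. *)
Lemma ideal_cocycle_extension : exists E : A -> dual B,
  [/\ linear E, bounded_operator E,
    forall a b z, E (a ** b) z = E b (ideal_rmul z a) + E a (ideal_lmul b z) &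
    forall x, E (ideal_val x) = D x].
Proof.
have [Dl _ Dd] := Dc; have [C C0 DC] := cocycle_bound Dc.
have [|||E [El Eb EE]] :=
    @Lim_bilinear _ _ (fun j a x => D (ideal_lmul a (e j)) x) (C * M).
- by move=> j x k a b; rewrite ideal_lmulP Dl.
- by move=> j a; exact: dual_linear.
- move=> j a x; rewrite (le_trans (DC _ _))// ler_wpM2r// -mulrA ler_wpM2l//.
  by rewrite mulrC norm_ideal_lmul.
(* The limit exists on products, which are total in the ideal. *)
have Eprod a (x y : B) :
    E a (x ** y) = D (ideal_lmul a x) y - D x (ideal_rmul y a).
  rewrite EE; apply: LimE.
  have [g gE] := cocycle_transpose y Dc.
  have cvg1 := dual_cvg (f := dual_ract (X := ideal_bimodule I) g a) (@eL x).
  have cvg2 := dual_cvg (f := D x) (@eR (ideal_rmul y a)).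
  (* The derivation identity for (a e_j) x moves e_j next to x and to y a, where the approximate
     identity absorbs it. *)
  suff -> : (fun j => D (ideal_lmul a (e j)) (x ** y)) = (fun j =>
      g (ideal_lmul a (e j ** x)) - D x (ideal_rmul y a ** e j)).
    by rewrite -gE; exact: cvgB cvg1 cvg2.
  apply/funext => j.
  have -> : ideal_lmul a (e j ** x) = ideal_lmul a (e j) ** x.
    by apply: val_inj; rewrite /= amulA.
  have -> : ideal_rmul y a ** e j = y ** ideal_lmul a (e j).
    by apply: val_inj; rewrite /= amulA.
  by rewrite gE Dd addrAC subrr add0r.
exists E; split=> // [a b z|x].
  (* The right-hand side as one functional of z, so that comparison on products suffices. *)
  pose h : dual (ideal_bimodule I) :=
    dual_lact (X := ideal_bimodule I) a (E b) +
    dual_ract (X := ideal_bimodule I) (E a) b.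
  rewrite -[RHS]/(h z); congr (dual_fun _ z); apply: dual_ideal_eq => x y.
  rewrite -[RHS]/(E b (ideal_rmul (x ** y) a) + E a (ideal_lmul b (x ** y))).
  have -> : ideal_rmul (x ** y) a = x ** ideal_rmul y a.
    by apply: val_inj; rewrite /= amulA.
  have -> : ideal_lmul b (x ** y) = ideal_lmul b x ** y.
    by apply: val_inj; rewrite /= amulA.
  rewrite !Eprod.
  have -> : ideal_lmul (a ** b) x = ideal_lmul a (ideal_lmul b x).
    by apply: val_inj; rewrite /= amulA.
  have -> : ideal_rmul y (a ** b) = ideal_rmul (ideal_rmul y a) b.
    by apply: val_inj; rewrite /= amulA.
  by ring.
apply: dual_ext => y; rewrite EE; apply: LimE.
have [g gE] := cocycle_transpose y Dc.
suff -> : (fun j => D (ideal_lmul (ideal_val x) (e j)) y) =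
    (fun j => g (x ** e j)).
  by rewrite -gE; exact: dual_cvg (@eR x).
by apply/funext => j; rewrite gE.
Qed.

(** The outer limit, G a b = lim_k E a (b e_k), extends each functional E a from I to A. *)
Lemma cocycle_restrict_surj :
  exists2 E : A -> dual A, cocycle E &
    forall x : B, restrict I (E (ideal_val x)) = D x.
Proof.
have [E [El [N EN] Ed EE]] := ideal_cocycle_extension.
have EN' a x : `|E a x| <= `|N| * `|a| * `|x|.
  by rewrite (le_trans (ler_dual_norm _ _))// ler_wpM2r// ler_normM.
have Eb j a b : `|E a (ideal_lmul b (e j))| <= `|N| * M * `|a| * `|b|.
  rewrite (le_trans (EN' _ _))// -!mulrA ler_wpM2l// mulrCA ler_wpM2l//.
  by rewrite mulrC norm_ideal_lmul.
have [|||G [Gl Gb GE]] :=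
    @Lim_bilinear _ _ (fun j a b => E a (ideal_lmul b (e j))) (`|N| * M).
- by move=> j b k a a'; rewrite El.
- by move=> j a k b b'; rewrite ideal_lmulP dualP.
- exact: Eb.
exists G; [split=> // a b c|move=> x].
  (* The identity for E yields u + w, the one for G requires v + w, and v - u is E b applied to c (a
     e_j - e_j a). *)
  pose u j := E b (ideal_rmul (ideal_lmul c (e j)) a).
  pose v j := E b (ideal_lmul (c ** a) (e j)).
  pose w j := E a (ideal_lmul (b ** c) (e j)).
  have ub j : `|u j| <= `|N| * `|b| * (`|c| * M * `|a|).
    rewrite (le_trans (EN' _ _))// ler_wpM2l ?mulr_ge0//.
    rewrite (le_trans (ler_norm_amul (\val (ideal_lmul c (e j))) a))//.
    by rewrite ler_wpM2r//; exact: norm_ideal_lmul.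
  have vb j : `|v j| <= _ := Eb j b (c ** a).
  have wb j : `|w j| <= _ := Eb j a (b ** c).
  (* Quasi-centrality makes the extension of functionals a bimodule map. *)
  have uv : Lim u = Lim v.
    apply/eqP; rewrite eq_sym -subr_eq0 addrC -mulN1r -(LimP _ ub vb).
    apply/eqP.
    apply: LimE.
    have cvg0 : ideal_lmul a (e j) - ideal_rmul (e j) a @[j --> tails J] --> 0.
      apply: cvg_norm_sub_le (qe a) => j.
      by rewrite !sub0r !normrN ideal_normE raddfB.
    have := dual_cvg (f := dual_ract (X := ideal_bimodule I) (E b) c) cvg0.
    rewrite linear0.
    suff -> : (fun j => -1 * u j + v j) =
        (fun j => dual_ract (X := ideal_bimodule I) (E b) c
          (ideal_lmul a (e j) - ideal_rmul (e j) a)) by [].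
    apply/funext => j; rewrite mulN1r addrC /u /v -dual_argB; congr (E b _).
    apply: val_inj; rewrite [LHS]raddfB.
    by rewrite -[RHS]/(c ** \val (_ - _)) raddfB /= amulBr !amulA.
  rewrite !GE -/v -/w -uv -[Lim u]mul1r -(LimP _ ub wb).
  congr Lim; apply/funext => j; rewrite Ed mul1r; congr (_ + E a _).
  by apply: val_inj; rewrite /= amulA.
apply: dual_ext => y; rewrite restrictE GE; apply: LimE.
by rewrite EE; exact: dual_cvg (@eR y).
Qed.

End Extension.

End QuasiCentral.

(** The extension of D to A is approximately inner. Restriction to I is contractive and commutes
    with forming inner derivations, so the restricted approximants approximate D. *)
Lemma ideal_approximately_weakly_amenable (R : realType)
    (A : banachAlgType R[i]) (I : closed_ideal A) :
  approximately_weakly_amenable A ->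
  (exists (J : directed_set) (e : J -> ideal_alg I),
    bounded_approximate_identity e /\ quasi_central e) ->
  approximately_weakly_amenable (ideal_alg I).
Proof.
move=> /approximately_weakly_amenable_cocycle wA [J [e [[[M eM] ee] qe]]].
apply/approximately_weakly_amenable_cocycle => D Dc.
have [Lim [LimP LimM LimE]] := generalized_limit R (tails_proper_filter J).
have [E /wA[K [f fE]] ED] := cocycle_restrict_surj eM (fun x => (ee x).1)
  (fun x => (ee x).2) qe LimP LimM LimE Dc.
exists K, (fun j => restrict I (f j)) => x.
apply: cvg_norm_sub_le (fE (ideal_val x)) => j.
by rewrite restrict_coad -ED -restrictB ler_norm_dual_comp.
Qed.

Theorem proposition2p2 (R : realType) (A : banachAlgType R[i])
    (I : closed_ideal A) :
  (approximately_weakly_amenable (quotient_alg I) ->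
     approximate_trace_extension I) /\
  (weakly_amenable A -> approximate_trace_extension I ->
     approximately_weakly_amenable (quotient_alg I)) /\
  (weakly_amenable (ideal_alg I) ->
     approximately_weakly_amenable (quotient_alg I) ->
     approximately_weakly_amenable A) /\
  (approximately_weakly_amenable A ->
     (exists (J : directed_set) (e : J -> ideal_alg I),
        bounded_approximate_identity e /\ quasi_central e) ->
     approximately_weakly_amenable (ideal_alg I)).

Proof.
split; first exact: quotient_approximate_trace_extension.
split; first exact: quotient_approximately_weakly_amenable.
split; first exact: extension_approximately_weakly_amenable.
exact: ideal_approximately_weakly_amenable.
Qed.
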